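(* For every $\lambda>0$, the sequence of iterates $(u_1^k,u_2^k)$ of the Schwarz algorithm with Robin interface operators, as described in the context, converges in $H^1(\Omega_1)\times H^1(\Omega_2)$ to a limit $(u_1^\lambda,u_2^\lambda)$ that satisfies $$u_1^\lambda(L_0)=\frac1H\int_0^H u_2^\lambda(L_0,z)\,dz,\qquad \frac{\partial u_1^\lambda}{\partial x}(L_0)=\frac1H\int_0^H\frac{\partial u_2^\lambda}{\partial x}(L_0,z)\,dz .$$
   Context: Geometry. Let $\Omega\subset\mathbb{R}^2$ be a bounded domain with coordinates $(x,z)$, and let $H>0$, $L_0>0$ be such that $\Omega\cap\{x<L_0\}=(0,L_0)\times(0,H)$. The boundary of $\Omega$ is divided into four parts: the left side $\Gamma_L=\{0\}\times(0,H)$, the top $\Gamma_T$ (which contains $(0,L_0)\times\{H\}$), the bottom $\Gamma_B$ (which contains $(0,L_0)\times\{0\}$), and the right side $\Gamma_R$ (of positive length, located in $\{x>L_0\}$). Set $\Omega_2=\Omega\cap\{x>L_0\}$, $\Gamma=\{L_0\}\times(0,H)$ (the interface, which is the part of $\partial\Omega_2$ on $\{x=L_0\}$), $\Gamma_T^2=\Gamma_T\cap\partial\Omega_2$, $\Gamma_B^2=\Gamma_B\cap\partial\Omega_2$. For the one-dimensional model, $\Omega_1$ denotes the interval $(0,L_0)$. The boundary of $\Omega_2$ consists of $\Gamma$, $\Gamma_T^2$, $\Gamma_B^2$, $\Gamma_R$. Data. $\kappa\ge 0$ is a constant, $F$ is a given function on $\Omega$, $\gamma_1$ and $\gamma_2$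 are given functions on $\Gamma_L$ and $\Gamma_R$. The domain and the data are assumed regular enough for the boundary value problems below to be well posed in $H^1$. The vertical average of a function $f$ of $z\in(0,H)$ is $\bar f=\frac1H\int_0^H f(z)\,dz$. Set $F_1=\bar F$ (vertical average, a function of $x\in(0,L_0)$) and $F_2=F|_{\Omega_2}$. For a function $u_2$ on $\Omega_2$, $\bar u_2(L_0)=\frac1H\int_0^H u_2(L_0,z)\,dz$ and $\frac{\partial\bar u_2}{\partial x}(L_0)=\frac1H\int_0^H\frac{\partial u_2}{\partial x}(L_0,z)\,dz$. Algorithm. Fix $\lambda>0$ and an initial guess $u_2^0$ on $\Omega_2$ (such that the interface quantities used below are defined). For each $k\ge0$, first solve the one-dimensional problem $$-\frac{\partial^2u_1^{k+1}}{\partial x^2}+\frac{\kappa}{H}u_1^{k+1}=F_1\ \text{ in }(0,L_0),\qquad u_1^{k+1}(0)=\bar\gamma_1,$$ $$\frac{\partial u_1^{k+1}}{\partial x}(L_0)+\lambda u_1^{k+1}(L_0)=\frac{\partial\bar u_2^{k}}{\partial x}(L_0)+\lambda\bar u_2^{k}(L_0),$$ and then solve the two-dimensional problem $$-\Delta u_2^{k+1}=F_2\ \text{ in }\Omega_2,\qquad \frac{\partial u_2^{k+1}}{\partial n}=0\ \text{ on }\Gamma_T^2,\qquad \frac{\partial u_2^{k+1}}{\partial n}+\kappa u_2^{k+1}=0\ \text{ on }\Gamma_B^2,\qquad u_2^{k+1}=\gamma_2\ \text{ on }\Gamma_R,$$ $$-\frac{\partial u_2^{k+1}}{\partial x}(L_0,z)+\lambda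 u_2^{k+1}(L_0,z)=-\frac{\partial u_1^{k+1}}{\partial x}(L_0)+\lambda u_1^{k+1}(L_0)\ \text{ for }(L_0,z)\in\Gamma,$$ where $n$ is the outward unit normal. *)

(* Defs.v *)
From HB Require Import structures.
From mathcomp Require Import all_boot all_order all_algebra.
From mathcomp Require Import all_classical all_reals all_analysis.
Set Implicit Arguments. Unset Strict Implicit. Unset Printing Implicit Defensive.
Import Order.TTheory GRing.Theory Num.Theory numFieldNormedType.Exports.
Local Open Scope classical_set_scope. Local Open Scope ring_scope.

Definition L2 d (T : measurableType d) (R : realType)
    (mu : {measure set T -> \bar R}) (D : set T) (f : T -> R) : Prop :=
  f \_ D \in Lfun mu 2%:E.

Definition L2_sqnorm d (T : measurableType d) (R : realType)
    (mu : {measure set T -> \bar R}) (D : set T) (f : T -> R) : \bar R :=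
  (\int[mu]_(x in D) ((f x) ^+ 2)%:E)%E.

Definition L2_cvg d (T : measurableType d) (R : realType)
    (mu : {measure set T -> \bar R}) (D : set T)
    (f_ : nat -> T -> R) (f : T -> R) : Prop :=
  [/\ forall n, L2 mu D (f_ n), L2 mu D f &
      L2_sqnorm mu D (fun x => f_ n x - f x) @[n --> \oo] --> 0%E].

Section Plane.
Context (R : realType).
Local Notation mR := (measurableTypeR R).

Definition leb2 : {measure set (mR * mR) -> \bar R} :=
  (@lebesgue_measure R \x @lebesgue_measure R)%E.

Definition d_x (f : R * R -> R) : R * R -> R := fun p => 'D_(1, 0) f p.
Definition d_z (f : R * R -> R) : R * R -> R := fun p => 'D_(0, 1) f p.

Fixpoint class_C (k : nat) (f : R * R -> R) : Prop :=
  if k is k'.+1 then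
    [/\ continuous f,
        forall p, derivable f p (1, 0) /\ derivable f p (0, 1),
        class_C k' (d_x f) & class_C k' (d_z f)]
  else continuous f.

Definition smooth (f : R * R -> R) : Prop := forall k, class_C k f.

Definition test_function (U : set (R * R)) (phi : R * R -> R) : Prop :=
  smooth phi /\
  exists K, [/\ compact K, K `<=` U & forall p, ~ K p -> phi p = 0].

Definition weak_gradient (U : set (R * R)) (f fx fz : R * R -> R) : Prop :=
  forall phi, test_function U phi ->
    [/\ \int[leb2]_(p in U) (f p * d_x phi p) =
          - (\int[leb2]_(p in U) (fx p * phi p)) &
        \int[leb2]_(p in U) (f p * d_z phi p) =
          - (\int[leb2]_(p in U) (fz p * phi p))].

(* An element of H^1(U), carried together with its weak gradient. Values
   outside U are irrelevant. *)
Record H1 (U : set (R * R)) := MkH1 {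
  H1_fun :> R * R -> R;
  H1_dx : R * R -> R;
  H1_dz : R * R -> R;
  H1_funL2 : L2 leb2 U H1_fun;
  H1_dxL2 : L2 leb2 U H1_dx;
  H1_dzL2 : L2 leb2 U H1_dz;
  H1_gradient : weak_gradient U H1_fun H1_dx H1_dz }.

Definition H1_sqnorm (U : set (R * R)) (u : H1 U) : \bar R :=
  (L2_sqnorm leb2 U u + L2_sqnorm leb2 U (H1_dx u)
   + L2_sqnorm leb2 U (H1_dz u))%E.

Definition H1_cvg (U : set (R * R)) (u_ : nat -> H1 U) (u : H1 U) : Prop :=
  [/\ L2_cvg leb2 U (fun n => u_ n) u,
      L2_cvg leb2 U (fun n => H1_dx (u_ n)) (H1_dx u) &
      L2_cvg leb2 U (fun n => H1_dz (u_ n)) (H1_dz u)].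

(* The library norm on R * R is the max norm; lengths need the Euclidean
   distance. *)
Definition euclid_dist (p q : R * R) : R :=
  Num.sqrt ((p.1 - q.1) ^+ 2 + (p.2 - q.2) ^+ 2).

Definition diameter (A : set (R * R)) : \bar R :=
  ereal_sup ([set 0%E] `|`
    [set e | exists p q, [/\ A p, A q & e = (euclid_dist p q)%:E]]).

Definition hausdorff1_size (delta : R) (A : set (R * R)) : \bar R :=
  ereal_inf [set e | exists C : nat -> set (R * R),
    [/\ A `<=` \bigcup_n C n, forall n, (diameter (C n) <= delta%:E)%E &
        e = (\sum_(0 <= n <oo) diameter (C n))%E]].

Definition hausdorff1 (A : set (R * R)) : \bar R :=
  ereal_sup [set hausdorff1_size delta A | delta in [set delta | 0 < delta]].

(* The one-dimensional Hausdorff measure on the Borel sets of the plane. *)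
Definition is_arc_length (ell : {measure set (mR * mR) -> \bar R}) : Prop :=
  forall A : set (mR * mR), measurable A -> ell A = hausdorff1 A.

Definition bdry (A : set (R * R)) : set (R * R) := closure A `\` interior A.

(* H^1(0, L): the primitives on [0, L] of square-integrable functions; the
   underlying function is thus the continuous representative, and its values
   at the end points are the usual ones. *)
Record H1I (L : R) := MkH1I {
  H1I_fun :> R -> R;
  H1I_d : R -> R;
  H1I_dL2 : L2 lebesgue_measure `]0, L[ H1I_d;
  H1I_primitive : forall x, 0 <= x <= L ->
    H1I_fun x = H1I_fun 0 + \int[lebesgue_measure]_(y in `]0, x[) H1I_d y }.

Definition H1I_cvg (L : R) (u_ : nat -> H1I L) (u : H1I L) : Prop :=
  L2_cvg lebesgue_measure `]0, L[ (fun n => u_ n) u /\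
  L2_cvg lebesgue_measure `]0, L[ (fun n => H1I_d (u_ n)) (H1I_d u).

(* w is the continuous representative of the derivative of u, so that u is in
   H^2(0, L) and w L is its derivative at L. *)
Definition is_derivative (L : R) (u w : H1I L) : Prop :=
  {ae lebesgue_measure, forall x : mR, 0 < x < L -> H1I_d u x = w x}.

Definition vmean (H : R) (f : R -> R) : R :=
  H^-1 * \int[lebesgue_measure]_(z in `]0, H[) f z.

End Plane.

Arguments leb2 {R}.

Record geometry (R : realType) := MkGeometry {
  Omega : set (R * R);
  height : R;
  L0 : R;
  Gamma_T : set (R * R);
  Gamma_B : set (R * R);
  Gamma_R : set (R * R);
  Gamma_L := [set p : R * R | p.1 = 0 /\ 0 < p.2 < height];
  Omega2 := Omega `&` [set p | L0 < p.1];
  Gamma := [set p : R * R | p.1 = L0 /\ 0 < p.2 < height];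
  height_gt0 : 0 < height;
  L0_gt0 : 0 < L0;
  Omega_domain : [/\ open Omega, connected Omega & bounded_set Omega];
  Omega_left : Omega `&` [set p | p.1 < L0] =
    [set p : R * R | 0 < p.1 < L0 /\ 0 < p.2 < height];
  Gamma_inside : Gamma `<=` Omega;
  (* Gamma is the part of the boundary of Omega2 on the line x = L0, up to
     its end points *)
  Omega2_interface : bdry Omega2 `&` [set p | p.1 = L0] = closure Gamma;
  Gamma_measurable : [/\
    measurable (Gamma_T : set (measurableTypeR R * measurableTypeR R)),
    measurable (Gamma_B : set (measurableTypeR R * measurableTypeR R)) &
    measurable (Gamma_R : set (measurableTypeR R * measurableTypeR R))];
  Gamma_bdry : Gamma_L `|` Gamma_T `|` Gamma_B `|` Gamma_R `<=` bdry Omega;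
  (* the corners may belong to none of the four parts *)
  Gamma_cover :
    hausdorff1 (bdry Omega `\` (Gamma_L `|` Gamma_T `|` Gamma_B `|` Gamma_R))
      = 0%E;
  Gamma_disjoint : trivIset [set: 'I_4]
    (fun i : 'I_4 => nth set0 [:: Gamma_L; Gamma_T; Gamma_B; Gamma_R] i);
  Gamma_T_left :
    [set p : R * R | 0 < p.1 < L0 /\ p.2 = height] `<=` Gamma_T;
  Gamma_B_left : [set p : R * R | 0 < p.1 < L0 /\ p.2 = 0] `<=` Gamma_B;
  Gamma_R_right : Gamma_R `<=` [set p | L0 < p.1];
  Gamma_R_length : (0 < hausdorff1 Gamma_R)%E }.

Section Problems.
Context (R : realType) (G : geometry R).
Local Notation mR := (measurableTypeR R).
Context (ell : {measure set (mR * mR) -> \bar R}).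
Local Notation O2 := (Omega2 G).
Local Notation H := (height G).
Local Notation L := (L0 G).

Definition Gamma_T2 : set (R * R) := Gamma_T G `&` bdry O2.
Definition Gamma_B2 : set (R * R) := Gamma_B G `&` bdry O2.

(* t is the trace of u on the boundary of Omega2: the L^2 limit of the
   boundary values of smooth functions converging to u in H^1. On the vertical
   segment Gamma arc length is dz. *)
Definition is_trace (u : H1 O2) (t : R * R -> R) : Prop :=
  exists phi_ : nat -> R * R -> R,
    [/\ forall n, smooth (phi_ n),
        [/\ L2_cvg leb2 O2 phi_ u,
            L2_cvg leb2 O2 (fun n => d_x (phi_ n)) (H1_dx u) &
            L2_cvg leb2 O2 (fun n => d_z (phi_ n)) (H1_dz u)],
        L2_cvg ell (bdry O2 `\` Gamma G) phi_ t &
        L2_cvg lebesgue_measure `]0, H[ (fun n z => phi_ n (L, z))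
          (fun z => t (L, z))].

(* Weak form, by Green's formula, of: - Delta u = f in Omega2,
   du/dn = h on S and du/dx = q on Gamma (where n = (-1, 0)). The test
   functions vanish on D, the remaining part of the boundary. *)
Definition green (u : H1 O2) (f : R * R -> R) (D S : set (R * R))
    (h : R * R -> R) (q : R -> R) : Prop :=
  forall (v : H1 O2) (s : R * R -> R), is_trace v s ->
    {ae ell, forall p : mR * mR, D p -> s p = 0} ->
    \int[leb2]_(p in O2) (H1_dx u p * H1_dx v p + H1_dz u p * H1_dz v p) =
      \int[leb2]_(p in O2) (f p * v p)
      + \int[ell]_(p in S) (h p * s p)
      - \int[lebesgue_measure]_(z in `]0, H[) (q z * s (L, z)).

(* q is the trace on Gamma of du/dx, for u with square-integrable Laplacian *)
Definition is_flux (u : H1 O2) (q : R -> R) : Prop :=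
  L2 lebesgue_measure `]0, H[ q /\
  exists2 f, L2 leb2 O2 f &
    green u f (bdry O2 `\` Gamma G) set0 (fun=> 0) q.

Definition problem1 (kappa lambda : R) (f : R -> R) (gamma r : R)
    (u du : H1I L) : Prop :=
  [/\ is_derivative u du,
      {ae lebesgue_measure, forall x : mR, 0 < x < L ->
        - H1I_d du x + kappa / H * u x = f x},
      u 0 = gamma &
      du L + lambda * u L = r].

(* t is the trace of u and q that of du/dx on Gamma *)
Definition problem2 (kappa lambda : R) (f gamma : R * R -> R) (g : R -> R)
    (u : H1 O2) (t : R * R -> R) (q : R -> R) : Prop :=
  [/\ is_trace u t,
      L2 lebesgue_measure `]0, H[ q,
      green u f (Gamma_R G) (Gamma_T2 `|` Gamma_B2)
        (fun p => - kappa * t p * \1_Gamma_B2 p) q,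
      {ae ell, forall p : mR * mR, Gamma_R G p -> t p = gamma p} &
      {ae lebesgue_measure, forall z : mR, 0 < z < H ->
        - q z + lambda * t (L, z) = g z}].

Definition lifts (w : H1 O2) (gamma : R * R -> R) : Prop :=
  exists2 s, is_trace w s &
    {ae ell, forall p : mR * mR, Gamma_R G p -> s p = gamma p}.

(* Well-posedness in the sense of Hadamard. The Dirichlet data are the traces
   on Gamma_R of H^1 functions, measured by the H^1 norm of their liftings. *)
Definition well_posed2 (kappa lambda : R) : Prop :=
  [/\ forall (f gamma : R * R -> R) (g : R -> R),
        L2 leb2 O2 f -> (exists w, lifts w gamma) ->
        L2 lebesgue_measure `]0, H[ g ->
        exists u t q, problem2 kappa lambda f gamma g u t q,
      forall (f gamma : R * R -> R) (g : R -> R) u t q u' t' q',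
        problem2 kappa lambda f gamma g u t q ->
        problem2 kappa lambda f gamma g u' t' q' ->
        ae_eq leb2 O2 u u' &
      exists C : R, forall (f gamma : R * R -> R) (g : R -> R) w u t q,
        L2 leb2 O2 f -> lifts w gamma ->
        L2 lebesgue_measure `]0, H[ g ->
        problem2 kappa lambda f gamma g u t q ->
        (H1_sqnorm u <= C%:E * (L2_sqnorm leb2 O2 f + H1_sqnorm w
           + L2_sqnorm lebesgue_measure `]0%R, H[ g))%E].

(* t_ k and q_ k are the traces of u2_ k and of its x-derivative on the
   interface. The term u1_ 0 plays no role. *)
Definition schwarz_iterates (kappa lambda : R) (F gamma1 gamma2 : R * R -> R)
    (u1_ du1_ : nat -> H1I L)
    (u2_ : nat -> H1 O2) (t_ : nat -> R * R -> R) (q_ : nat -> R -> R) :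
    Prop :=
  [/\ is_trace (u2_ 0%N) (t_ 0%N),
      is_flux (u2_ 0%N) (q_ 0%N) &
      forall k,
        problem1 kappa lambda (fun x => vmean H (fun z => F (x, z)))
          (vmean H (fun z => gamma1 (0, z)))
          (vmean H (q_ k) + lambda * vmean H (fun z => t_ k (L, z)))
          (u1_ k.+1) (du1_ k.+1) /\
        problem2 kappa lambda F gamma2
          (fun=> - du1_ k.+1 L + lambda * u1_ k.+1 L)
          (u2_ k.+1) (t_ k.+1) (q_ k.+1)].

End Problems.

(* Main.v *)
Require Import Defs.
From HB Require Import structures.
From mathcomp Require Import all_boot all_order all_algebra.
From mathcomp Require Import all_classical all_reals all_analysis.
From mathcomp Require Import measurable_realfun ring lra.
Set Implicit Arguments. Unset Strict Implicit. Unset Printing Implicit Defensive.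
Import Order.TTheory GRing.Theory Num.Theory numFieldNormedType.Exports.
Local Open Scope classical_set_scope. Local Open Scope ring_scope.

(** The two subproblems exchange a single real number in each direction. The
    interval receives [s = mean (du2/dx) + lambda * mean u2] on the interface
    and answers with [r = lambda * u1 L - u1' L]; the plane domain receives the
    constant Robin datum [r] and answers with the next [s]. Both answers are
    affine in the datum, so everything rests on how much each subproblem
    contracts differences.

    On the interval, a difference [u] of two solutions satisfies [u'' = c * u]
    with [c = kappa / H >= 0] and [u 0 = 0]. Then [(u * u')' = u'^2 + c * u^2]
    is nonnegative, so [u L] and [u' L] have the same sign; moreover each is
    bounded by a fixed multiple of the other, which excludes that one of them
    is negligible. Hence
    [|lambda * u L - u' L| <= theta * |u' L + lambda * u L|] with a constant
    [theta < 1] ([problem1_stability]).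

    On the plane domain, testing the weak form of a difference of two solutions
    with that difference itself gives, for its trace [t] and its flux [q] on
    the interface, [\int q * t <= 0], since the Dirichlet energy and the Robin
    term on the bottom have a sign. Together with
    [(q + lambda t)^2 = (- q + lambda t)^2 + 4 lambda q t = r^2 + 4 lambda q t]
    and the Cauchy-Schwarz inequality for the mean, this yields [|s| <= |r|]
    ([problem2_stability]).

    So consecutive values of [s] contract by [theta] and converge
    ([contraction_cvg]). The limit of [s] is an affine combination of its first
    two values, and the same combination of the first two interval solutions
    solves the limit interval problem; the limit plane problem is solvable by
    well-posedness. The interval iterates converge because a difference and its
    derivative are monotone in absolute value, hence bounded by their values at
    [L]; the plane iterates converge by the continuity part of well-posedness,
    applied to differences. In the limit both Robin conditions hold together
    for the means, and adding and subtracting them separates continuity of the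
    value from continuity of the derivative. *)

(** * Square-integrable functions *)

Section SquareIntegrable.
Context d (T : measurableType d) (R : realType)
  (mu : {measure set T -> \bar R}).
Implicit Types (D E : set T) (f g h : T -> R).

Lemma L2P D f : measurable D ->
  L2 mu D f <->
  measurable_fun D f /\ mu.-integrable D (EFin \o (fun x => f x ^+ 2)).
Proof.
move=> mD.
have sqE : EFin \o (fun x => (f \_ D) x ^+ 2) =
    (EFin \o (fun x => f x ^+ 2)) \_ D.
  apply/funext => x; rewrite /patch /=; case: ifP => // _.
  by rewrite expr0n.
split.
  move=> fL2; split.
    apply/(measurable_restrictT f mD).
    by move: fL2; rewrite /L2 inE => /andP[/[!inE]].
  apply/(integrable_mkcond _ mD); rewrite -sqE.
  exact: Lfun2_integrable_sqr fL2.
move=> [mf if2]; rewrite /L2 inE; apply/andP; split; rewrite inE/=.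
  exact/(measurable_restrictT f mD).
rewrite /finite_norm unlock /= poweR_lty//.
move/(integrable_mkcond _ mD) : if2; rewrite -sqE => /integrableP[_].
congr (_ < _)%E; apply: eq_integral => x _ /=.
by rewrite ger0_norm ?sqr_ge0// powR_mulrn// real_normK ?num_real.
Qed.

Lemma L2_measurable D f : measurable D -> L2 mu D f -> measurable_fun D f.
Proof. by move=> mD /(L2P f mD)[]. Qed.

Lemma L2_lin D f g (a b : R) : L2 mu D f -> L2 mu D g ->
  L2 mu D (fun x => a * f x + b * g x).
Proof.
move=> fL gL; rewrite /L2.
have -> : (fun x => a * f x + b * g x) \_ D =
  a *: (f \_ D : T -> R) + (b *: (g \_ D : T -> R) + 0).
  apply/funext => x; rewrite /patch /= !fctE /=; case: ifP => // _.
    by rewrite addr0.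
  by rewrite !scaler0 !addr0.
have p1 : (1 <= 2%:E :> \bar R)%E by rewrite lee_fin ler1n.
have cl := Lfun_submod_closed mu p1.
by apply: cl.2 => //; apply: cl.2 => //; exact: cl.1.
Qed.

Lemma L2B D f g : L2 mu D f -> L2 mu D g -> L2 mu D (fun x => f x - g x).
Proof.
move=> fL gL; have := L2_lin 1 (-1) fL gL.
by congr (L2 mu D _); apply/funext => x; rewrite mul1r mulN1r.
Qed.

Lemma L20 D : L2 mu D (fun=> 0).
Proof.
have p1 : (1 <= 2%:E :> \bar R)%E by rewrite lee_fin ler1n.
rewrite /L2 (_ : _ \_ D = 0); first exact: (Lfun_submod_closed mu p1).1.
by apply/funext => x; rewrite /patch; case: ifP.
Qed.

Lemma L2Z D f (a : R) : L2 mu D f -> L2 mu D (fun x => a * f x).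
Proof.
move=> fL; have := L2_lin a 0 fL fL.
by congr (L2 mu D _); apply/funext => x; rewrite mul0r addr0.
Qed.

Lemma L2S D E f : measurable D -> measurable E -> E `<=` D ->
  L2 mu D f -> L2 mu E f.
Proof.
move=> mD mE ED /(L2P f mD)[mf if2]; apply/(L2P f mE); split.
  exact: measurable_funS mf.
exact: integrableS if2.
Qed.

Lemma L2_mul_indic D E f : measurable D -> measurable E ->
  L2 mu D f -> L2 mu D (fun x => f x * \1_E x).
Proof.
move=> mD mE fL.
have mf := L2_measurable mD fL.
have mfE : measurable_fun D (fun x => f x * \1_E x).
  by apply: measurable_funM => //; exact: measurable_indic.
apply/(L2P _ mD); split=> //.
have /(L2P _ mD)[_ if2] := fL.
apply: le_integrable if2 => //.
  by apply/measurable_EFinP; exact: measurable_funX.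
move=> x Dx /=; rewrite lee_fin !ger0_norm ?sqr_ge0// exprMn.
rewrite indicE; case: (_ \in _); first by rewrite expr1n mulr1.
by rewrite expr0n mulr0 sqr_ge0.
Qed.

Lemma L2_mul_integrable D f g : measurable D -> L2 mu D f -> L2 mu D g ->
  mu.-integrable D (EFin \o (fun x => f x * g x)).
Proof.
move=> mD fL gL; apply/(integrable_mkcond _ mD).
rewrite (_ : _ \_ D = EFin \o ((f \_ D) \* (g \_ D))).
  by apply/Lfun1_integrable; exact: Lfun2_mul_Lfun1 fL gL.
by apply/funext => x; rewrite /patch /=; case: ifP => //; rewrite mulr0.
Qed.

Lemma L2_bounded D f (M : R) : measurable D -> (mu D < +oo)%E ->
  measurable_fun D f -> (forall x, D x -> `|f x| <= M) -> L2 mu D f.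
Proof.
move=> mD Dfin mf fM; apply/(L2P f mD); split=> //.
apply: measurable_bounded_integrable => //.
  exact: measurable_funX.
exists (M ^+ 2); split; first exact: num_real.
move=> N MN x Dx /=; rewrite normrX (le_trans _ (ltW MN))//.
by rewrite ler_sqr ?nnegrE ?normr_ge0 ?(le_trans _ (fM _ Dx))// fM.
Qed.

Lemma L2_cst D (c : R) : measurable D -> (mu D < +oo)%E -> L2 mu D (fun=> c).
Proof. by move=> mD Dfin; exact: (@L2_bounded _ _ `|c|). Qed.

Lemma L2_integrable D f : measurable D -> (mu D < +oo)%E -> L2 mu D f ->
  mu.-integrable D (EFin \o f).
Proof.
move=> mD Dfin fL.
have := L2_mul_integrable mD fL (L2_cst 1 mD Dfin).
by congr (integrable _ _ (_ \o _)); apply/funext => x; rewrite mulr1.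
Qed.

Lemma L2_sqnorm_ge0 D f : (0 <= L2_sqnorm mu D f)%E.
Proof. by apply: integral_ge0 => x _; rewrite lee_fin sqr_ge0. Qed.

Lemma L2_sqnorm_zero D : L2_sqnorm mu D (fun=> 0 : R) = 0%E.
Proof.
by rewrite /L2_sqnorm; under eq_integral do rewrite expr0n; rewrite integral0.
Qed.

Lemma L2_cvg_squeeze D (f_ : nat -> T -> R) f (e : nat -> \bar R) :
  (forall n, L2 mu D (f_ n)) -> L2 mu D f ->
  (forall n, (L2_sqnorm mu D (fun x => f_ n x - f x)%R <= e n)%E) ->
  e @ \oo --> 0%E -> L2_cvg mu D f_ f.
Proof.
move=> fnL fL fe e0; split=> //.
apply: (@squeeze_cvge _ _ _ _ (cst 0%E) _ e) => //.
  by apply: nearW => n; rewrite L2_sqnorm_ge0 fe.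
exact: cvg_cst.
Qed.

(** The Schwarz iterates satisfy their equations from rank 1 on only. *)
Lemma L2_cvg_shiftS D (f_ : nat -> T -> R) f :
  L2 mu D (f_ 0%N) -> L2_cvg mu D (fun n => f_ n.+1) f -> L2_cvg mu D f_ f.
Proof.
by move=> f0L [fnL fL fcvg]; split=> //; [case|rewrite -cvg_shiftS].
Qed.

Lemma L2_cvgB D (f_ g_ : nat -> T -> R) f g : measurable D ->
  L2_cvg mu D f_ f -> L2_cvg mu D g_ g ->
  L2_cvg mu D (fun n x => f_ n x - g_ n x) (fun x => f x - g x).
Proof.
move=> mD [fnL fL fcvg] [gnL gL gcvg].
pose e n : \bar R := (2%:E * (L2_sqnorm mu D (fun x => f_ n x - f x)%R +
                     L2_sqnorm mu D (fun x => g_ n x - g x)%R))%E.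
apply: (@L2_cvg_squeeze _ _ _ e).
- by move=> n; exact: L2B.
- exact: L2B.
- move=> n; rewrite /e /L2_sqnorm.
  have /(L2P _ mD)[mF iF] := L2B (fnL n) fL.
  have /(L2P _ mD)[mG iG] := L2B (gnL n) gL.
  have /(L2P _ mD)[mH iH] := L2B (L2B (fnL n) (gnL n)) (L2B fL gL).
  rewrite -ge0_integralD//=; last 4 first.
  + by move=> x _; rewrite lee_fin sqr_ge0.
  + exact: (measurable_int mu iF).
  + by move=> x _; rewrite lee_fin sqr_ge0.
  + exact: (measurable_int mu iG).
  rewrite -ge0_integralZl//=; last 2 first.
  + by apply: emeasurable_funD; [exact: (measurable_int mu iF)|
      exact: (measurable_int mu iG)].
  + by move=> x _; rewrite -EFinD lee_fin addr_ge0// sqr_ge0.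
  apply: ge0_le_integral => //=.
  + by move=> x _; rewrite lee_fin sqr_ge0.
  + exact: (measurable_int mu iH).
  + by apply: emeasurable_funM => //; apply: emeasurable_funD;
      [exact: (measurable_int mu iF)|exact: (measurable_int mu iG)].
  + move=> x _; rewrite -EFinD -EFinM lee_fin -subr_ge0.
    (* 2 (a^2 + b^2) - (a - b)^2 = (a + b)^2 *)
    rewrite (_ : _ - _ = (f_ n x - f x + (g_ n x - g x)) ^+ 2) ?sqr_ge0//.
    by ring.
- rewrite (_ : 0%E = (2%:E * (0 + 0))%E); last by rewrite adde0 mule0.
  by apply: cvgeZl => //; apply: cvgeD.
Qed.

Lemma L2_cvg_zero D : L2_cvg mu D (fun _ _ => 0 : R) (fun=> 0).
Proof.
split; [by move=> _; exact: L20|exact: L20|].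
rewrite (_ : (fun n => _) = cst 0%E); first exact: cvg_cst.
apply/funext => n; rewrite -[RHS](L2_sqnorm_zero D).
by congr L2_sqnorm; apply/funext => x; rewrite subrr.
Qed.

Lemma Rintegral_ae_eq D f g : measurable D ->
  measurable_fun D f -> measurable_fun D g ->
  {ae mu, forall x, D x -> f x = g x} ->
  \int[mu]_(x in D) f x = \int[mu]_(x in D) g x.
Proof.
move=> mD mf mg fg; congr fine; apply: ae_eq_integral => //.
- exact/measurable_EFinP.
- exact/measurable_EFinP.
- by apply: filterS fg => x + Dx => /(_ Dx) ->.
Qed.

Lemma Rintegral_ae_eq0 D f : measurable D -> measurable_fun D f ->
  {ae mu, forall x, D x -> f x = 0} -> \int[mu]_(x in D) f x = 0.
Proof.
move=> mD mf f0; rewrite (@Rintegral_ae_eq D f (fun=> 0))//.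
by rewrite Rintegral_cst// mul0r.
Qed.

Lemma Rintegral_le0 D f : (forall x, D x -> f x <= 0) ->
  \int[mu]_(x in D) f x <= 0.
Proof.
move=> f0; rewrite /Rintegral -oppr_ge0 -fineN fine_ge0//.
have -> : (\int[mu]_(x in D) (f x)%:E = - \int[mu]_(x in D) (- f x)%:E)%E.
  rewrite -integral_ge0N.
    by apply: eq_integral => x _; rewrite EFinN oppeK.
  by move=> x Dx; rewrite lee_fin oppr_ge0 f0.
by rewrite oppeK integral_ge0// => x Dx; rewrite lee_fin oppr_ge0 f0.
Qed.

Lemma Rintegral_mul0l D h : \int[mu]_(x in D) (0 * h x) = 0.
Proof.
rewrite /Rintegral (eq_integral (cst 0%E)) ?integral0//.
by move=> x _; rewrite mul0r.
Qed.

Lemma Rintegral_mulBl D f g h : measurable D ->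
  L2 mu D f -> L2 mu D g -> L2 mu D h ->
  \int[mu]_(x in D) ((f x - g x) * h x) =
  \int[mu]_(x in D) (f x * h x) - \int[mu]_(x in D) (g x * h x).
Proof.
move=> mD fL gL hL; rewrite -RintegralB//.
- by apply: eq_Rintegral => x _; rewrite mulrBl.
- exact: L2_mul_integrable.
- exact: L2_mul_integrable.
Qed.

Lemma Rintegral_sqr_comb D f g (a b : R) :
  measurable D -> L2 mu D f -> L2 mu D g ->
  \int[mu]_(x in D) ((a * f x + b * g x) ^+ 2) =
  a ^+ 2 * \int[mu]_(x in D) (f x * f x) +
  2 * a * b * \int[mu]_(x in D) (f x * g x) +
  b ^+ 2 * \int[mu]_(x in D) (g x * g x).
Proof.
move=> mD fL gL.
have ff := L2_mul_integrable mD fL fL; have fg := L2_mul_integrable mD fL gL.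
have gg := L2_mul_integrable mD gL gL.
have iZ (c : R) (h : T -> R) : mu.-integrable D (EFin \o h) ->
    mu.-integrable D (EFin \o (fun x => c * h x)).
  by move=> hi; exact: (integrableZl mD c hi).
rewrite -!RintegralZl// -RintegralD; [|by []|exact: iZ|exact: iZ].
rewrite -RintegralD; [|by []| |exact: iZ].
  by apply: eq_Rintegral => x _; ring.
exact: (integrableD mD (iZ (a ^+ 2) _ ff) (iZ (2 * a * b) _ fg)).
Qed.

End SquareIntegrable.

(** * Borel sets of the plane *)

Section PlaneBorel.
Context (R : realType).
Local Notation mR := (measurableTypeR R).

(** The plane carries the product of the Borel sigma-algebras of the line; it
    contains the open sets because each of them is the countable union of the
    squares with rational centres and radii that it contains. *)
Lemma open_measurable_plane (A : set (R * R)) :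
  open A -> measurable (A : set (mR * mR)).
Proof.
move=> oA.
pose B (a b c : rat) : set (mR * mR) :=
  ball (ratr a : R) (ratr c) `*` ball (ratr b : R) (ratr c).
pose C a b c : set (mR * mR) := if `[< B a b c `<=` A >] then B a b c else set0.
have -> : A = \bigcup_a \bigcup_b \bigcup_c C a b c.
  apply/seteqP; split=> [x Ax|x [a _ [b _ [c _]]]]; last first.
    by rewrite /C; case: asboolP => // BA /BA.
  have [r r0 rA] : exists2 r : R, 0 < r & ball x r `<=` A.
    have /nbhs_ballP[r /= r0 rA] : nbhs x A by exact: open_nbhs_nbhs.
    by exists r.
  have [c c0 cr] : exists2 c : rat, 0 < (ratr c : R) & (ratr c : R) < r / 2.
    have /rat_in_itvoo[c] : 0 < r / 2 by rewrite divr_gt0.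
    by rewrite in_itv /= => /andP[]; exists c.
  have near_rat (y : R) : exists a : rat, ball (ratr a : R) (ratr c) y.
    have /rat_in_itvoo[a] : y - ratr c < y + ratr c.
      by rewrite ltrBlDr -addrA ltrDl addr_gt0.
    rewrite in_itv /= => /andP[a1 a2]; exists a; rewrite /ball /= ltr_norml.
    by apply/andP; split; lra.
  have [a ya] := near_rat x.1; have [b zb] := near_rat x.2.
  exists a => //; exists b => //; exists c => //; rewrite /C.
  case: asboolP; first by [].
  case=> -[y1 y2] [/= b1 b2]; apply: rA.
  have tri (u v w : R) : ball w (ratr c) u -> ball w (ratr c) v -> ball u r v.
    rewrite /ball /= => uw vw.
    have -> : u - v = (w - v) - (w - u) by ring.
    rewrite (le_lt_trans (ler_normB _ _))//; lra.
  by split=> /=; [exact: tri ya b1|exact: tri zb b2].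
rewrite /B; do 3! apply: bigcupT_measurable_rat => ?.
rewrite /C; case: asboolP => // _.
by apply: measurableX; apply: open_measurable; exact: ball_open.
Qed.

Lemma closed_measurable_plane (A : set (R * R)) :
  closed A -> measurable (A : set (mR * mR)).
Proof.
move=> cA; rewrite -[A]setCK; apply: measurableC.
by apply: open_measurable_plane; exact: closed_openC.
Qed.

Lemma compact_measurable_plane (K : set (R * R)) :
  compact K -> measurable (K : set (mR * mR)).
Proof. by move=> cK; apply: closed_measurable_plane; exact: compact_closed. Qed.

Lemma right_half_plane_open (a : R) : open [set p : R * R | a < p.1].
Proof.
rewrite (_ : [set p | _] = fst @^-1` `]a, +oo[); last first.
  by apply/seteqP; split=> p /=; rewrite in_itv/= andbT.
by apply: open_comp; [move=> p _; exact: cvg_fst|exact: interval_open].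
Qed.

Lemma continuous_measurable_plane (f : R * R -> R) :
  continuous f -> measurable_fun setT (f : mR * mR -> R).
Proof.
move=> cf; apply: (measurability _ (RGenOpens.measurableE R)).
move=> _ [_ [a [b ->] <-]]; rewrite setTI; apply: open_measurable_plane.
by apply: open_comp => [x _|]; [exact: cf|exact: interval_open].
Qed.

Lemma compact_finite_plane (K : set (R * R)) :
  compact K -> (leb2 (K : set (mR * mR)) < +oo)%E.
Proof.
move=> cK.
have mK := compact_measurable_plane cK.
have [M [_ KM]] := compact_bounded cK.
pose S : set R := `[- (M + 1), M + 1]%classic.
have KS : K `<=` S `*` S.
  move=> p Kp; have /= : `|p| <= M + 1 by apply: KM => //; rewrite ltrDl.
  rewrite prod_normE ge_max => /andP[p1 p2].
  by split; rewrite /S /= in_itv/= -ler_norml.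
have mS : measurable (S : set mR) by exact: measurable_itv.
have Sfin : (lebesgue_measure (S : set mR) < +oo)%E.
  by rewrite /S lebesgue_measure_itv /=; case: ifP => _; rewrite ltry.
apply: (@le_lt_trans _ _ (leb2 (S `*` S : set (mR * mR)))).
  by apply: le_measure; rewrite ?inE//; exact: measurableX.
have -> : leb2 (S `*` S : set (mR * mR)) =
    (lebesgue_measure (S : set mR) * lebesgue_measure (S : set mR))%E.
  exact: product_measure1E.
by rewrite lte_mul_pinfty// ge0_fin_numE.
Qed.

Lemma continuous_compact_support_L2 (U K : set (R * R)) (f : R * R -> R) :
  measurable (U : set (mR * mR)) -> continuous f -> compact K ->
  (forall p, ~ K p -> f p = 0) -> L2 leb2 U f.
Proof.
move=> mU cf cK f0.
have mK := compact_measurable_plane cK.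
have mf := continuous_measurable_plane cf.
have [M [_ fM]] : bounded_set (f @` K).
  by apply: compact_bounded; apply: continuous_compact => //;
    exact: continuous_subspaceT.
have : L2 leb2 (K : set (mR * mR)) f.
  apply: (@L2_bounded _ _ _ _ _ _ (M + 1)) => //.
  - exact: compact_finite_plane.
  - exact: measurable_funS mf.
  - by move=> p Kp; apply: (fM (M + 1)); [rewrite ltrDl|exists p].
have fKE : f \_ K = f.
  apply/funext => p; rewrite /patch.
  by case: ifPn => // /negP pK; rewrite f0// => Kp; apply: pK; rewrite inE.
rewrite /L2 fKE => fL; apply: (@L2S _ _ _ _ setT) => //.
by rewrite /L2 patch_setT.
Qed.

End PlaneBorel.

(** * The equation u'' = c u on an interval *)

Section ShootingODE.
Context (R : realType).

Lemma MVT_sub (L a b : R) (f df : R -> R) :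
  (forall x, 0 < x < L -> is_derive x 1 f (df x)) ->
  {within `[0, L], continuous f} -> 0 <= a -> a <= b -> b <= L ->
  exists2 x, a <= x <= b & f b - f a = df x * (b - a).
Proof.
move=> fd fc a0 ab bL.
have [||x] := @MVT_segment R f df a b ab.
- move=> x; rewrite in_itv/= => /andP[ax xb]; apply: fd.
  by rewrite (le_lt_trans a0 ax) (lt_le_trans xb bL).
- apply: continuous_subspaceW fc => x /=; rewrite !in_itv/= => /andP[ax xb].
  by rewrite (le_trans a0 ax) (le_trans xb bL).
by rewrite in_itv/=; exists x.
Qed.

Context (L c : R) (u w : R -> R).
Context (L_gt0 : 0 < L) (c_ge0 : 0 <= c).
Context (u_deriv : forall x, 0 < x < L -> is_derive x 1 u (w x))
  (w_deriv : forall x, 0 < x < L -> is_derive x 1 w (c * u x)).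
Context (u_cont : {within `[0, L], continuous u})
  (w_cont : {within `[0, L], continuous w}).
Context (u0 : u 0 = 0).

(** The derivative [w^2 + c u^2] of [u w] is nonnegative and [u w] vanishes
    at 0. *)
Lemma shooting_mul_ge0 x : 0 <= x <= L -> 0 <= u x * w x.
Proof.
move=> /andP[x0 xL].
have [||y _] := @MVT_sub L 0 x (u \* w)
    (fun y => u y * (c * u y) + w y * w y) _ _ (lexx 0) x0 xL.
- by move=> y yL; have := is_deriveM (u_deriv yL) (w_deriv yL).
- by move=> y; apply: continuousM; [exact: u_cont|exact: w_cont].
rewrite /= u0 mul0r !subr0 => ->; apply: mulr_ge0 => //.
by rewrite addr_ge0// -?expr2 ?sqr_ge0// mulrCA mulr_ge0// -expr2 sqr_ge0.
Qed.

(** By [shooting_mul_ge0], [(u^2)' = 2 u w] is nonnegative; the next lemma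
    uses [(w^2)' = 2 c u w] in the same way. *)
Lemma shooting_sup x : 0 <= x <= L -> `|u x| <= `|u L|.
Proof.
move=> /andP[x0 xL].
rewrite -ler_sqr ?nnegrE// !real_normK ?num_real// -subr_ge0.
have [||y /andP[xy yL]] := @MVT_sub L x L (u \* u)
    (fun y => u y * w y + u y * w y) _ _ x0 xL (lexx L).
- by move=> y yL; exact: is_deriveM (u_deriv yL) (u_deriv yL).
- by move=> y; apply: continuousM; exact: u_cont.
rewrite /= -!expr2 => ->; rewrite mulr_ge0 ?subr_ge0// addr_ge0//;
by rewrite shooting_mul_ge0// (le_trans x0).
Qed.

Lemma shooting_deriv_sup x : 0 <= x <= L -> `|w x| <= `|w L|.
Proof.
move=> /andP[x0 xL].
rewrite -ler_sqr ?nnegrE// !real_normK ?num_real// -subr_ge0.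
have [||y /andP[xy yL]] := @MVT_sub L x L (w \* w)
    (fun y => w y * (c * u y) + w y * (c * u y)) _ _ x0 xL (lexx L).
- by move=> y yL; exact: is_deriveM (w_deriv yL) (w_deriv yL).
- by move=> y; apply: continuousM; exact: w_cont.
rewrite /= -!expr2 => ->; rewrite mulr_ge0 ?subr_ge0// addr_ge0//;
by rewrite mulrCA mulr_ge0// mulrC shooting_mul_ge0// (le_trans x0).
Qed.

Lemma shooting_end_le : `|u L| <= L * `|w L|.
Proof.
have [y yL] := MVT_sub u_deriv u_cont (lexx 0) (ltW L_gt0) (lexx L).
rewrite u0 !subr0 => ->; rewrite normrM mulrC (gtr0_norm L_gt0).
by rewrite ler_wpM2l ?(ltW L_gt0)// shooting_deriv_sup.
Qed.

(** [L^-1 u L] is a value [w y], and [w L] exceeds it by the integral of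
    [c u] over a part of the interval, on which [|u| <= |u L|]. *)
Lemma shooting_deriv_end_le : `|w L| <= (L^-1 + c * L) * `|u L|.
Proof.
have [y /andP[y0 yL]] := MVT_sub u_deriv u_cont (lexx 0) (ltW L_gt0) (lexx L).
rewrite u0 !subr0 => uLE.
have [z /andP[yz zL] wE] := MVT_sub w_deriv w_cont y0 yL (lexx L).
have -> : w L = L^-1 * u L + c * u z * (L - y).
  by rewrite -wE uLE; field; rewrite gt_eqF.
rewrite (le_trans (ler_normD _ _))// mulrDl !normrM.
rewrite ger0_norm ?invr_ge0 ?(ltW L_gt0)// lerD2l.
rewrite (ger0_norm c_ge0) -!mulrA ler_wpM2l// mulrC.
apply: ler_pM => //; last by rewrite shooting_sup// (le_trans y0).
by rewrite ger0_norm ?subr_ge0// gerBl.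
Qed.

End ShootingODE.

Section RobinRate.
Context (R : realType).

(** If [p, q >= 0] satisfy [p <= C q] and [q <= C p], then
    [|p - q| <= (C - 1) / (C + 1) * (p + q)]. With [p = lambda |u L|] and
    [q = |u' L|], the end-point bounds above allow [lambda L] in the first
    inequality and [(L^-1 + c L) / lambda] in the second; [C] is larger than
    both, and at least 1. *)
Definition robin_rate (lambda L c : R) : R :=
  let C := 1 + lambda * L + (L^-1 + c * L) / lambda in (C - 1) / (C + 1).

Lemma robin_rate_bounds (lambda L c : R) : 0 < lambda -> 0 < L -> 0 <= c ->
  0 <= robin_rate lambda L c < 1.
Proof.
move=> l0 L0 c0; rewrite /robin_rate; set C := 1 + _ + _.
have C1 : 1 <= C.
  by rewrite /C -addrA lerDl addr_ge0 ?divr_ge0 ?addr_ge0 ?invr_ge0 ?mulr_ge0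
    ?(ltW l0) ?(ltW L0).
rewrite divr_ge0 ?subr_ge0//=; last by lra.
by rewrite ltr_pdivrMr; lra.
Qed.

Lemma normrD_same_sign (a b : R) : 0 <= a * b -> `|a + b| = `|a| + `|b|.
Proof.
move=> ab0; apply: (@pexpIrn _ 2) => //; rewrite ?nnegrE ?addr_ge0//.
by rewrite !sqrrD !real_normK ?num_real// -normrM ger0_norm// sqrrD.
Qed.

Lemma robin_rateP (lambda L c a b : R) : 0 < lambda -> 0 < L -> 0 <= c ->
  0 <= a * b -> `|a| <= L * `|b| -> `|b| <= (L^-1 + c * L) * `|a| ->
  `|lambda * a - b| <= robin_rate lambda L c * `|b + lambda * a|.
Proof.
move=> l0 L0 c0 ab0 aLb bMa.
pose p := lambda * `|a|; pose q := `|b|.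
have p0 : 0 <= p by rewrite mulr_ge0// ltW.
have q0 : 0 <= q by rewrite /q normr_ge0.
have pqE : p * q = lambda * (a * b).
  by rewrite /p /q -mulrA -normrM ger0_norm.
have p2 : p ^+ 2 = (lambda * a) ^+ 2.
  by rewrite /p !exprMn real_normK ?num_real.
have q2 : q ^+ 2 = b ^+ 2 by rewrite real_normK ?num_real.
have -> : `|lambda * a - b| = `|p - q|.
  apply: (@pexpIrn _ 2) => //; rewrite ?nnegrE//.
  rewrite !real_normK ?num_real// !sqrrB p2 q2 pqE; ring.
have -> : `|b + lambda * a| = p + q.
  rewrite addrC normrD_same_sign; last by rewrite -mulrA mulr_ge0// ltW.
  by rewrite normrM (gtr0_norm l0).
rewrite /robin_rate; set A := lambda * L; set B := _ / lambda.
have A0 : 0 <= A by rewrite mulr_ge0// ltW.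
have B0 : 0 <= B.
  by rewrite divr_ge0 ?addr_ge0 ?invr_ge0 ?mulr_ge0 ?(ltW l0) ?(ltW L0).
have pA : p <= A * q by rewrite /p /A -mulrA ler_wpM2l// ltW.
have qB : q <= B * p by rewrite /q /p /B mulrA divfK ?gt_eqF.
have Ap := mulr_ge0 A0 p0; have Aq := mulr_ge0 A0 q0.
have Bp := mulr_ge0 B0 p0; have Bq := mulr_ge0 B0 q0.
rewrite mulrAC ler_pdivlMr; last by lra.
have -> : `|p - q| * (1 + A + B + 1) = `|(p - q) * (1 + A + B + 1)|.
  by rewrite normrM (@ger0_norm _ (1 + A + B + 1)) ?addr_ge0.
by rewrite ler_norml; apply/andP; split; nra.
Qed.

End RobinRate.

(** * Primitives and H^1 of an interval *)

Section Primitives.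
Context (R : realType) (L : R).
Local Notation mR := (measurableTypeR R).
Local Notation mu := (@lebesgue_measure R).
Local Notation I := (`]0, L[%classic : set mR).

Lemma itv_measure_fin (a b : R) : (mu (`]a, b[%classic : set mR) < +oo)%E.
Proof. by rewrite lebesgue_measure_itv /=; case: ifP => _; rewrite ltry. Qed.

Lemma fine_itv_measure (a : R) :
  0 < a -> fine (mu (`]0, a[%classic : set mR)) = a.
Proof.
by move=> a0; rewrite lebesgue_measure_itv /= lte_fin a0 oppr0 addr0.
Qed.

Lemma L2_sqnorm_itv_cst (a c : R) : 0 < a ->
  L2_sqnorm mu (`]0, a[%classic : set mR) (fun=> c) = (a * c ^+ 2)%:E.
Proof.
move=> a0; rewrite /L2_sqnorm integral_cst//= lebesgue_measure_itv/= lte_fin a0.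
by rewrite oppr0 addr0 -EFinM mulrC.
Qed.

Lemma integrable_zero_extension (d : R -> R) (J : interval R) :
  mu.-integrable I (EFin \o d) -> mu.-integrable [set` J] (EFin \o (d \_ I)).
Proof.
move=> di.
have dE : EFin \o (d \_ I) = (EFin \o d) \_ I.
  by apply/funext => y; rewrite /patch /=; case: ifP.
have mI : measurable I by exact: measurable_itv.
apply: (@integrableS _ _ _ mu (setT : set mR)) => //.
have /integrable_mkcond : mu.-integrable I (EFin \o d) by [].
by rewrite dE; apply.
Qed.

(** The results on parametrized integrals concern closed intervals; extending
    the integrand by 0 makes them available for integrals over open
    intervals of functions that are controlled inside [`]0, L[] only. *)
Lemma Rintegral_open_closed (d : R -> R) x : x <= L ->
  mu.-integrable I (EFin \o d) ->
  \int[mu]_(y in `]0, x[) d y = \int[mu]_(y in `[0, x]) (d \_ I) y.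
Proof.
move=> xL di.
have iS J := integrable_zero_extension J di.
rewrite -Rintegral_itv_obnd_cbnd// -Rintegral_itv_bndo_bndc//.
apply: eq_Rintegral => y; rewrite inE/= in_itv/= => /andP[y0 yx].
by rewrite patchE mem_set//= in_itv/= y0 (lt_le_trans yx xL).
Qed.

Lemma primitive_continuous (f d : R -> R) : 0 <= L ->
  mu.-integrable I (EFin \o d) ->
  (forall x, 0 <= x <= L -> f x = f 0 + \int[mu]_(y in `]0, x[) d y) ->
  {within `[0, L], continuous f}.
Proof.
move=> L0 di fE.
have dIi := integrable_zero_extension `[0, L] di.
have Fc := parameterized_integral_continuous L0 dIi.
have Gc : {within `[0, L], continuous
    (fun x : R => f 0 + \int[mu]_(y in `[0, x]) (d \_ I) y)}.
  by move=> x; exact: (cvgD (cvg_cst _) (Fc x)).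
apply: subspace_eq_continuous Gc => x; rewrite inE/= in_itv/= => x0L.
have /andP[_ xL] := x0L.
by rewrite /from_subspace (fE x)// Rintegral_open_closed.
Qed.

(** A primitive whose density agrees almost everywhere with a continuous
    function is classically differentiable: this turns the weak one-dimensional
    problem into the classical system for [(u, u')]. *)
Lemma primitive_is_derive (f d h : R -> R) :
  mu.-integrable I (EFin \o d) ->
  (forall x, 0 <= x <= L -> f x = f 0 + \int[mu]_(y in `]0, x[) d y) ->
  {ae mu, forall x : mR, 0 < x < L -> d x = h x} ->
  {in `]0, L[, continuous h} ->
  forall x, 0 < x < L -> is_derive x 1 f (h x).
Proof.
move=> di fE dh hc x xI.
have mh : measurable_fun I (h : mR -> R).
  apply: open_continuous_measurable_fun; first exact: interval_open.
  by move=> y; rewrite inE/= => yI; exact: hc.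
have md : measurable_fun I (d : mR -> R).
  by move/(measurable_int mu) : di => /measurable_EFinP.
have hi : mu.-integrable I (EFin \o h).
  apply/integrableP; split; first exact/measurable_EFinP.
  have /integrableP[_] := di; congr (_ < _)%E; apply: ae_eq_integral => //.
  - by apply/measurable_EFinP; exact: measurableT_comp.
  - by apply/measurable_EFinP; exact: measurableT_comp.
  - apply: filterS dh => y dhy yI /=; rewrite dhy//.
have fE' y : 0 <= y <= L -> f y = f 0 + \int[mu]_(z in `[0, y]) (h \_ I) z.
  move=> /andP[y0 yL]; rewrite (fE y) ?y0// -Rintegral_open_closed//.
  have yI : `]0, y[ `<=` I.
    by move=> z; rewrite /= !in_itv/= => /andP[-> /lt_le_trans ->].
  congr (_ + _); apply: Rintegral_ae_eq => //.
  - exact: measurable_funS yI md.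
  - exact: measurable_funS yI mh.
  - by apply: filterS dh => z dhz /yI; rewrite /= in_itv/=; exact: dhz.
have hIi := integrable_zero_extension `[0, L] hi.
have /andP[x0 xL] := xI.
have xin : x \in `]0, L[ by rewrite in_itv.
have hxE : (h \_ I) x = h x by rewrite patchE mem_set.
have hIx : {for x, continuous (h \_ I)}.
  rewrite /prop_for /continuous_at hxE; apply: cvg_trans (hc x xin).
  apply: near_eq_cvg; near=> y; rewrite patchE mem_set//=.
  near: y; exact: near_in_itvoo.
have [Fd FE] := continuous_FTC1_closed xL hIi x0 hIx.
have Fis := derivableP Fd.
rewrite -derive1E FE hxE in Fis.
have := is_deriveD (is_derive_cst (f 0) x 1) Fis; rewrite add0r.
apply: near_eq_is_derive; near=> y; rewrite /= -[LHS]/(f 0 + _) -fE'//.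
have : y \in `]0, L[ by near: y; exact: near_in_itvoo.
by rewrite in_itv/= => /andP[/ltW -> /ltW ->].
Unshelve. all: by end_near. Qed.

End Primitives.

Section SobolevInterval.
Context (R : realType) (L : R).
Local Notation mR := (measurableTypeR R).
Local Notation mu := (@lebesgue_measure R).
Local Notation I := (`]0, L[%classic : set mR).

Lemma H1I_d_integrable (u : H1I L) : mu.-integrable I (EFin \o H1I_d u).
Proof.
apply: L2_integrable (H1I_dL2 u); first exact: measurable_itv.
exact: itv_measure_fin.
Qed.

Lemma H1I_continuous (u : H1I L) : 0 <= L -> {within `[0, L], continuous u}.
Proof.
move=> L0; apply: (primitive_continuous L0 (H1I_d_integrable u)).
exact: H1I_primitive.
Qed.

Lemma within_cc_continuous_oo (f : R -> R) : 0 < L ->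
  {within `[0, L], continuous f} -> {in `]0, L[, continuous f}.
Proof. by move=> L0 /(continuous_within_itvP f L0)[]. Qed.

Lemma bounded_continuous_L2 (f : R -> R) (M : R) : 0 < L ->
  {within `[0, L], continuous f} ->
  (forall x, 0 <= x <= L -> `|f x| <= M) ->
  L2 mu I f /\ (L2_sqnorm mu I f <= (L * M ^+ 2)%:E)%E.
Proof.
move=> L0 fc fM.
have mf : measurable_fun I (f : mR -> R).
  apply: open_continuous_measurable_fun; first exact: interval_open.
  move=> y; rewrite inE/= => yI; exact: (within_cc_continuous_oo L0 fc).
have fM' x : I x -> `|f x| <= M.
  by rewrite /= in_itv/= => /andP[/ltW x0 /ltW xL]; rewrite fM// x0.
split.
  by apply: L2_bounded fM' => //; exact: itv_measure_fin.
rewrite -(L2_sqnorm_itv_cst M L0) /L2_sqnorm.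
apply: ge0_le_integral => //=.
- by move=> x _; rewrite lee_fin sqr_ge0.
- by apply/measurable_EFinP; exact: measurable_funX.
- move=> x xI; rewrite lee_fin -[leLHS]real_normK ?num_real//.
  by rewrite ler_sqr ?nnegrE ?(le_trans _ (fM' _ xI))// fM'.
Qed.

Lemma H1I_L2 (u : H1I L) : 0 < L -> L2 mu I u.
Proof.
move=> L0; have uc := H1I_continuous (u := u) (ltW L0).
have [M [_ uM]] : bounded_set (u @` `[0, L]).
  apply: compact_bounded; apply: continuous_compact => //.
  exact: segment_compact.
have [|//] := bounded_continuous_L2 (M := M + 1) L0 uc.
by move=> x x0L; apply: (uM (M + 1)); [rewrite ltrDl|exists x].
Qed.

Fact H1I_comb_primitive (a b : R) (u v : H1I L) x : 0 <= x <= L ->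
  a * u x + b * v x = a * u 0 + b * v 0 +
    \int[mu]_(y in `]0, x[) (a * H1I_d u y + b * H1I_d v y).
Proof.
move=> /andP[x0 xL].
have iS (w : H1I L) : mu.-integrable `]0, x[ (EFin \o H1I_d w).
  apply: integrableS (H1I_d_integrable w) => // y; rewrite /= !in_itv/=.
  by move=> /andP[-> yx]; exact: lt_le_trans xL.
rewrite RintegralD//; [|exact: integrableZl (iS u)|exact: integrableZl (iS v)].
rewrite !RintegralZl// (H1I_primitive u) ?x0// (H1I_primitive v) ?x0//.
by ring.
Qed.

Definition H1I_comb (a b : R) (u v : H1I L) : H1I L :=
  @MkH1I _ _ _ (fun y => a * H1I_d u y + b * H1I_d v y)
    (L2_lin a b (H1I_dL2 u) (H1I_dL2 v)) (H1I_comb_primitive a b u v).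

End SobolevInterval.

(** * The one-dimensional problem *)

Section OneDimensionalProblem.
Context (R : realType) (G : geometry R) (kappa lambda : R).
Local Notation mR := (measurableTypeR R).
Local Notation mu := (@lebesgue_measure R).
Local Notation H := (height G).
Local Notation L := (L0 G).
Local Notation I := (`]0, L[%classic : set mR).

Lemma problem1_comb a b f g gf gg rf rg (u du v dv : H1I L) :
  problem1 kappa lambda f gf rf u du -> problem1 kappa lambda g gg rg v dv ->
  problem1 kappa lambda (fun x => a * f x + b * g x) (a * gf + b * gg)
    (a * rf + b * rg) (H1I_comb a b u v) (H1I_comb a b du dv).
Proof.
move=> [du_ uf u0 uL] [dv_ vg v0 vL]; split.
- by apply: filterS2 du_ dv_ => x + + xI => /(_ xI) /= -> /(_ xI) ->.
- apply: filterS2 uf vg => x + + xI => /(_ xI) /= <- /(_ xI) <-.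
  by ring.
- by rewrite /= u0 v0.
- by rewrite /= -uL -vL; ring.
Qed.

Lemma problem1_sub f gamma r s (u du v dv : H1I L) :
  problem1 kappa lambda f gamma r u du ->
  problem1 kappa lambda f gamma s v dv ->
  problem1 kappa lambda (fun=> 0) 0 (r - s)
    (H1I_comb 1 (-1) u v) (H1I_comb 1 (-1) du dv).
Proof.
move=> uP vP; have := problem1_comb 1 (-1) uP vP.
rewrite !mul1r !mulN1r subrr.
by congr problem1; apply/funext => x; rewrite mul1r mulN1r subrr.
Qed.

(** Since [u] and [du] are largest in absolute value at [L], where they have
    the same sign, [|r| = |du L| + lambda |u L|] controls both uniformly. *)
Lemma problem1_homogeneous_bounds r (u du : H1I L) :
  0 <= kappa -> 0 < lambda -> problem1 kappa lambda (fun=> 0) 0 r u du ->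
  [/\ `|lambda * u L - du L| <= robin_rate lambda L (kappa / H) * `|r|,
      (L2_sqnorm mu I u <= (L * (r / lambda) ^+ 2)%:E)%E &
      (L2_sqnorm mu I (H1I_d u) <= (L * r ^+ 2)%:E)%E].
Proof.
move=> k0 l0 [u_du ueq u0 uL].
have Lgt0 := L0_gt0 G; have Lge0 := ltW Lgt0.
set c := kappa / H.
have c0 : 0 <= c by rewrite divr_ge0// ltW// height_gt0.
have uc := H1I_continuous (u := u) Lge0.
have duc := H1I_continuous (u := du) Lge0.
have ud x : 0 < x < L -> is_derive x 1 u (du x).
  apply: primitive_is_derive (H1I_d_integrable u) (H1I_primitive u) u_du _ x.
  exact: within_cc_continuous_oo.
have dud x : 0 < x < L -> is_derive x 1 du (c * u x).
  apply: (primitive_is_derive (H1I_d_integrable du) (H1I_primitive du)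
    (h := fun x => c * u x)).
    apply: filterS ueq => y + yI => /(_ yI) /eqP.
    by rewrite addrC subr_eq0 => /eqP.
  move=> y yI; apply: cvgM; first exact: cvg_cst.
  exact: within_cc_continuous_oo uc _ yI.
have LL : 0 <= L <= L by rewrite Lge0 lexx.
have udu := shooting_mul_ge0 c0 ud dud uc duc u0 LL.
have supu := shooting_sup c0 ud dud uc duc u0.
have supdu := shooting_deriv_sup c0 ud dud uc duc u0.
(* no cancellation in the Robin datum *)
have rE : `|r| = `|du L| + lambda * `|u L|.
  rewrite -uL normrD_same_sign; last first.
    by rewrite mulrC -mulrA mulr_ge0// ltW.
  by rewrite normrM (gtr0_norm l0).
split.
- rewrite -uL; apply: robin_rateP => //.
    exact: shooting_end_le ud dud uc duc u0.
  exact: shooting_deriv_end_le ud dud uc duc u0.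
- have [|_ uN] := bounded_continuous_L2 (M := `|r| / lambda) Lgt0 uc.
    move=> x xI; rewrite ler_pdivlMr// mulrC.
    by rewrite (le_trans (ler_wpM2l (ltW l0) (supu x xI)))// rE lerDr.
  move: uN; congr (_ <= (_ * _)%:E)%E.
  by rewrite !expr_div_n real_normK ?num_real.
- have [|_ duN] := bounded_continuous_L2 (M := `|r|) Lgt0 duc.
    move=> x xI; rewrite (le_trans (supdu x xI))// rE lerDl.
    by rewrite mulr_ge0// ltW.
  rewrite real_normK ?num_real// in duN; apply: le_trans duN.
  have mu_d : measurable_fun I (H1I_d u : mR -> R).
    by apply: L2_measurable (H1I_dL2 u); exact: measurable_itv.
  have mdu : measurable_fun I (du : mR -> R).
    by apply: L2_measurable (H1I_L2 du Lgt0); exact: measurable_itv.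
  rewrite /L2_sqnorm (@ae_eq_integral _ _ _ mu I (fun x => (du x ^+ 2)%:E))//.
  + by apply/measurable_EFinP; exact: measurable_funX.
  + by apply/measurable_EFinP; exact: measurable_funX.
  + apply: filterS u_du => x + xI => -> //.
Qed.

Lemma problem1_stability f gamma r s (u du v dv : H1I L) :
  0 <= kappa -> 0 < lambda ->
  problem1 kappa lambda f gamma r u du ->
  problem1 kappa lambda f gamma s v dv ->
  [/\ `|lambda * u L - du L - (lambda * v L - dv L)| <=
        robin_rate lambda L (kappa / H) * `|r - s|,
      (L2_sqnorm mu I (fun x => u x - v x)%R <=
        (L / lambda ^+ 2 * (r - s) ^+ 2)%:E)%E &
      (L2_sqnorm mu I (fun x => H1I_d u x - H1I_d v x)%R <=
        (L * (r - s) ^+ 2)%:E)%E].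
Proof.
move=> k0 l0 uP vP.
have [Bout Bu Bd] :=
  problem1_homogeneous_bounds k0 l0 (problem1_sub uP vP).
split.
- by move: Bout; congr (`|_| <= _); rewrite /=; ring.
- move: Bu; congr (_ <= _)%E.
    by congr L2_sqnorm; apply/funext => x /=; rewrite mul1r mulN1r.
  by congr EFin; rewrite expr_div_n; ring.
- move: Bd; congr (_ <= _)%E.
  by congr L2_sqnorm; apply/funext => x /=; rewrite mul1r mulN1r.
Qed.

End OneDimensionalProblem.

(** * Smooth functions and H^1 of a plane domain *)

Section SmoothFunctions.
Context (R : realType).
Implicit Types f g phi : R * R -> R.

Lemma class_C_sub k f g :
  class_C k f -> class_C k g -> class_C k (fun p => f p - g p).
Proof.
elim: k f g => [|k IH] f g /=.
  by move=> fc gc p; apply: cvgB; [exact: fc|exact: gc].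
move=> [fc fd fx fz] [gc gd gx gz]; split.
- by move=> p; apply: cvgB; [exact: fc|exact: gc].
- by move=> p; have [? ?] := fd p; have [? ?] := gd p; split; exact: derivableB.
- rewrite (_ : d_x _ = fun p => d_x f p - d_x g p); first exact: IH.
  by apply/funext => p; apply: deriveB; [exact: (fd p).1|exact: (gd p).1].
- rewrite (_ : d_z _ = fun p => d_z f p - d_z g p); first exact: IH.
  by apply/funext => p; apply: deriveB; [exact: (fd p).2|exact: (gd p).2].
Qed.

Lemma smooth_sub f g : smooth f -> smooth g -> smooth (fun p => f p - g p).
Proof. by move=> fs gs k; exact: class_C_sub. Qed.

Lemma smooth_derivable f p : smooth f ->
  derivable f p (1, 0) /\ derivable f p (0, 1).
Proof. by move=> /(_ 1%N) [_ /(_ p)]. Qed.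

Lemma d_x_sub f g : smooth f -> smooth g ->
  d_x (fun p => f p - g p) = fun p => d_x f p - d_x g p.
Proof.
move=> fs gs; apply/funext => p.
apply: deriveB; first exact: (smooth_derivable p fs).1.
exact: (smooth_derivable p gs).1.
Qed.

Lemma d_z_sub f g : smooth f -> smooth g ->
  d_z (fun p => f p - g p) = fun p => d_z f p - d_z g p.
Proof.
move=> fs gs; apply/funext => p.
apply: deriveB; first exact: (smooth_derivable p fs).2.
exact: (smooth_derivable p gs).2.
Qed.

Lemma d_x_zero : d_x (fun=> 0 : R) = fun=> 0.
Proof. by apply/funext => p; exact: derive_cst. Qed.

Lemma d_z_zero : d_z (fun=> 0 : R) = fun=> 0.
Proof. by apply/funext => p; exact: derive_cst. Qed.

Lemma smooth_zero : smooth (fun=> 0 : R).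
Proof.
elim=> [|k IH] /=; first by move=> p; exact: cvg_cst.
split; first by move=> p; exact: cvg_cst.
- by move=> p; split; exact: derivable_cst.
- by rewrite d_x_zero.
- by rewrite d_z_zero.
Qed.

Lemma derive_eq0_outside (K : set (R * R)) phi v : closed K ->
  (forall p, ~ K p -> phi p = 0) -> forall p, ~ K p -> 'D_v phi p = 0.
Proof.
move=> cK phi0 p pK.
rewrite -[RHS](derive_cst (0 : R) p v); apply: near_eq_derive.
have : open_nbhs p (~` K) by split=> //; exact: closed_openC.
by move=> /open_nbhs_nbhs; apply: filterS => y /phi0.
Qed.

(** Linearity of the weak gradient needs every product in its definition to be
    integrable, which follows from square integrability of both factors. *)
Lemma test_function_L2 (U : set (R * R)) phi :
  measurable (U : set (measurableTypeR R * measurableTypeR R)) ->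
  test_function U phi ->
  [/\ L2 leb2 U phi, L2 leb2 U (d_x phi) & L2 leb2 U (d_z phi)].
Proof.
move=> mU [phis [K [cK _ phi0]]].
have clK : closed K by apply: compact_closed => //; exact: norm_hausdorff.
have [phic _ phix phiz] := phis 1%N.
split; apply: (continuous_compact_support_L2 mU _ cK) => //.
- by move=> p pK; exact: derive_eq0_outside pK.
- by move=> p pK; exact: derive_eq0_outside pK.
Qed.

End SmoothFunctions.

Section SobolevPlane.
Context (R : realType) (U : set (R * R)).
Local Notation mR := (measurableTypeR R).

Lemma weak_gradient_zero : weak_gradient U (fun=> 0) (fun=> 0) (fun=> 0).
Proof. by move=> phi _; rewrite !Rintegral_mul0l oppr0. Qed.

Definition H1_zero : H1 U :=
  MkH1 (L20 leb2 U) (L20 leb2 U) (L20 leb2 U) weak_gradient_zero.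

Lemma H1_sqnorm_zero : H1_sqnorm H1_zero = 0%E.
Proof.
by rewrite /H1_sqnorm /= !L2_sqnorm_zero !adde0.
Qed.

Context (mU : measurable (U : set (mR * mR))).

Lemma weak_gradient_sub f fx fz g gx gz :
  L2 leb2 U f -> L2 leb2 U fx -> L2 leb2 U fz ->
  L2 leb2 U g -> L2 leb2 U gx -> L2 leb2 U gz ->
  weak_gradient U f fx fz -> weak_gradient U g gx gz ->
  weak_gradient U (fun p => f p - g p) (fun p => fx p - gx p)
    (fun p => fz p - gz p).
Proof.
move=> fL fxL fzL gL gxL gzL wf wg phi phiT.
have [pL pxL pzL] := test_function_L2 mU phiT.
have [fxE fzE] := wf _ phiT; have [gxE gzE] := wg _ phiT.
rewrite (Rintegral_mulBl mU fL gL pxL) (Rintegral_mulBl mU fxL gxL pL).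
rewrite (Rintegral_mulBl mU fL gL pzL) (Rintegral_mulBl mU fzL gzL pL).
by rewrite fxE fzE gxE gzE; split; ring.
Qed.

Definition H1_sub (u v : H1 U) : H1 U :=
  MkH1 (L2B (H1_funL2 u) (H1_funL2 v)) (L2B (H1_dxL2 u) (H1_dxL2 v))
    (L2B (H1_dzL2 u) (H1_dzL2 v))
    (weak_gradient_sub (H1_funL2 u) (H1_dxL2 u) (H1_dzL2 u)
       (H1_funL2 v) (H1_dxL2 v) (H1_dzL2 v) (H1_gradient u) (H1_gradient v)).

Lemma H1_cvg_of_sqnorm (u_ : nat -> H1 U) (u : H1 U) (e : nat -> \bar R) :
  (forall n, (H1_sqnorm (H1_sub (u_ n.+1) u) <= e n)%E) ->
  e @ \oo --> 0%E -> H1_cvg u_ u.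
Proof.
move=> ue e0.
have le1 (a b c : \bar R) : (0 <= b -> 0 <= c -> a <= a + b + c)%E.
  by move=> b0 c0; rewrite -addeA leeDl// adde_ge0.
split; apply: L2_cvg_shiftS;
  [exact: H1_funL2|idtac|exact: H1_dxL2|idtac|exact: H1_dzL2|idtac].
- apply: L2_cvg_squeeze e0; [by move=> n; exact: H1_funL2|exact: H1_funL2|].
  by move=> n; apply: le_trans (ue n); apply: le1; exact: L2_sqnorm_ge0.
- apply: L2_cvg_squeeze e0; [by move=> n; exact: H1_dxL2|exact: H1_dxL2|].
  move=> n; apply: le_trans (ue n); rewrite /H1_sqnorm.
  by rewrite [X in (_ <= X + _)%E]addeC; apply: le1; exact: L2_sqnorm_ge0.
- apply: L2_cvg_squeeze e0; [by move=> n; exact: H1_dzL2|exact: H1_dzL2|].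
  move=> n; apply: le_trans (ue n); rewrite /H1_sqnorm addeC addeA.
  by apply: le1; exact: L2_sqnorm_ge0.
Qed.

End SobolevPlane.

(** * Geometry of the interface *)

Section InterfaceGeometry.
Context (R : realType) (G : geometry R).
Local Notation mR := (measurableTypeR R).
Local Notation O2 := (Omega2 G).

Lemma Omega2_open : open O2.
Proof.
have [oO _ _] := Omega_domain G.
by apply: openI => //; exact: right_half_plane_open.
Qed.

Lemma Omega2_measurable : measurable (O2 : set (mR * mR)).
Proof. exact: open_measurable_plane Omega2_open. Qed.

Lemma bdry_measurable (A : set (R * R)) : measurable (bdry A : set (mR * mR)).
Proof.
apply: measurableD.
  by apply: closed_measurable_plane; exact: closed_closure.
by apply: open_measurable_plane; exact: open_interior.
Qed.

Lemma Gamma_interface_measurable : measurable (Gamma G : set (mR * mR)).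
Proof.
rewrite (_ : Gamma G = [set L0 G] `*` `]0, height G[); last first.
  by apply/seteqP; split=> p; rewrite /Gamma /= in_itv.
by apply: measurableX => //; exact: measurable_itv.
Qed.

Local Notation wall := (bdry O2 `\` Gamma G).

Lemma wall_measurable : measurable (wall : set (mR * mR)).
Proof.
by apply: measurableD; [exact: bdry_measurable|
  exact: Gamma_interface_measurable].
Qed.

Lemma bdry_not_interface p : bdry (Omega G) p -> ~ Gamma G p.
Proof.
have [oO _ _] := Omega_domain G.
move=> [_ pO] /(@Gamma_inside _ G) pG; apply: pO.
by move/interior_id : oO => ->.
Qed.

Lemma Gamma_TB2_wall : Gamma_T2 G `|` Gamma_B2 G `<=` wall.
Proof.
move=> p [] [pT pb]; split=> //; apply: bdry_not_interface;
  apply: (@Gamma_bdry _ G).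
- by left; left; right.
- by left; right.
Qed.

Lemma Gamma_B2_measurable : measurable (Gamma_B2 G : set (mR * mR)).
Proof.
have [_ mB _] := Gamma_measurable G.
by apply: measurableI => //; exact: bdry_measurable.
Qed.

Lemma Gamma_TB2_measurable :
  measurable (Gamma_T2 G `|` Gamma_B2 G : set (mR * mR)).
Proof.
have [mT _ _] := Gamma_measurable G.
apply: measurableU; last exact: Gamma_B2_measurable.
by apply: measurableI => //; exact: bdry_measurable.
Qed.

(** To the right of [x = L0] the sets [Omega] and [Omega2] coincide, hence so
    do their boundaries. *)
Lemma Gamma_R_wall : Gamma_R G `<=` wall.
Proof.
move=> p pR; have pL := Gamma_R_right pR.
have pb : bdry (Omega G) p by apply: (@Gamma_bdry _ G); right.
split; last exact: bdry_not_interface.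
have [pc pi] := pb; split; last first.
  by move=> /(interiorS (@subIsetl _ _ _)).
move=> B Bp.
have nL : nbhs p [set q : R * R | L0 G < q.1].
  by apply: open_nbhs_nbhs; split=> //; exact: right_half_plane_open.
have [q [qO [qL qB]]] := pc _ (filterI nL Bp).
by exists q.
Qed.

End InterfaceGeometry.

(** * The two-dimensional problem *)

Section VerticalMean.
Context (R : realType) (H : R).
Local Notation mR := (measurableTypeR R).
Local Notation mu := (@lebesgue_measure R).
Local Notation J := (`]0, H[%classic : set mR).

Lemma vmean_lin a b f g : L2 mu J f -> L2 mu J g ->
  vmean H (fun z => a * f z + b * g z) = a * vmean H f + b * vmean H g.
Proof.
move=> fL gL; have mJ : measurable J by exact: measurable_itv.
have fi := L2_integrable mJ (itv_measure_fin 0 H) fL.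
have gi := L2_integrable mJ (itv_measure_fin 0 H) gL.
rewrite /vmean RintegralD//; [|exact: integrableZl fi|exact: integrableZl gi].
by rewrite !RintegralZl//; ring.
Qed.

Lemma vmeanB f g : L2 mu J f -> L2 mu J g ->
  vmean H (fun z => f z - g z) = vmean H f - vmean H g.
Proof.
move=> fL gL; have := vmean_lin 1 (-1) fL gL; rewrite mul1r mulN1r => <-.
by congr vmean; apply/funext => z; rewrite mul1r mulN1r.
Qed.

Lemma vmean_sqr_le g : 0 < H -> L2 mu J g ->
  H * vmean H g ^+ 2 <= \int[mu]_(z in J) (g z * g z).
Proof.
move=> H0 gL; have mJ : measurable J by exact: measurable_itv.
have oneL : L2 mu J (fun=> 1 : R) := L2_cst 1 mJ (itv_measure_fin 0 H).
set m := vmean H g.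
have mE : \int[mu]_(z in J) (g z * 1) = H * m.
  under eq_Rintegral do rewrite mulr1.
  by rewrite /m /vmean mulrA divff ?gt_eqF// mul1r.
have oneE : \int[mu]_(z in J) (1 * 1 : R) = H.
  by rewrite Rintegral_cst// !mul1r fine_itv_measure.
have := Rintegral_sqr_comb 1 (- m) mJ gL oneL.
rewrite mE oneE => E.
(* the variance is nonnegative *)
have : 0 <= \int[mu]_(x in J) ((1 * g x + - m * 1) ^+ 2).
  by apply: Rintegral_ge0 => x _; exact: sqr_ge0.
by rewrite E; nra.
Qed.

End VerticalMean.

Section TwoDimensionalProblem.
Context (R : realType) (G : geometry R).
Local Notation mR := (measurableTypeR R).
Context (ell : {measure set (mR * mR) -> \bar R}).
Local Notation O2 := (Omega2 G).
Local Notation H := (height G).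
Local Notation L := (L0 G).
Local Notation wall := (bdry O2 `\` Gamma G).
Local Notation mu := (@lebesgue_measure R).
Local Notation J := (`]0, H[%classic : set mR).
Local Notation mO2 := (Omega2_measurable G).
Local Notation S := (Gamma_T2 G `|` Gamma_B2 G).

Lemma trace_wall_L2 (u : H1 O2) t : is_trace ell u t -> L2 ell wall t.
Proof. by case=> phi [_ _ []]. Qed.

Lemma trace_interface_L2 (u : H1 O2) t :
  is_trace ell u t -> L2 mu J (fun z => t (L, z)).
Proof. by case=> phi [_ _ _ []]. Qed.

Lemma trace_TB2_L2 (u : H1 O2) t : is_trace ell u t -> L2 ell S t.
Proof.
move=> /trace_wall_L2; apply: L2S.
- exact: wall_measurable.
- exact: Gamma_TB2_measurable.
- exact: Gamma_TB2_wall.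
Qed.

Lemma robin_flux_L2 (kappa : R) (u : H1 O2) t : is_trace ell u t ->
  L2 ell S (fun p => - kappa * t p * \1_(Gamma_B2 G) p).
Proof.
move=> /trace_wall_L2 tL; apply: L2_mul_indic.
- exact: Gamma_TB2_measurable.
- exact: Gamma_B2_measurable.
- apply: L2Z; apply: L2S tL.
  + exact: wall_measurable.
  + exact: Gamma_TB2_measurable.
  + exact: Gamma_TB2_wall.
Qed.

Lemma is_trace_sub (u v : H1 O2) t s : is_trace ell u t -> is_trace ell v s ->
  is_trace ell (H1_sub mO2 u v) (fun p => t p - s p).
Proof.
move=> [f_ [fs [fu fux fuz] fw fi]] [g_ [gs [gu gux guz] gw gi]].
exists (fun n p => f_ n p - g_ n p); split.
- by move=> n; exact: smooth_sub.
- split; first exact: (L2_cvgB mO2).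
  + rewrite (_ : (fun n => _) = fun n p => d_x (f_ n) p - d_x (g_ n) p).
      exact: (L2_cvgB mO2).
    by apply/funext => n; exact: d_x_sub.
  + rewrite (_ : (fun n => _) = fun n p => d_z (f_ n) p - d_z (g_ n) p).
      exact: (L2_cvgB mO2).
    by apply/funext => n; exact: d_z_sub.
- by apply: L2_cvgB => //; exact: wall_measurable.
- by apply: L2_cvgB => //; exact: measurable_itv.
Qed.

Lemma is_trace_zero : is_trace ell (H1_zero O2) (fun=> 0).
Proof.
exists (fun n p => 0); split.
- by move=> n; exact: smooth_zero.
- by rewrite /= d_x_zero d_z_zero; split; exact: L2_cvg_zero.
- exact: L2_cvg_zero.
- exact: L2_cvg_zero.
Qed.

Lemma lifts_zero : lifts ell (H1_zero O2) (fun=> 0).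
Proof.
by exists (fun=> 0); [exact: is_trace_zero|exact: nearW].
Qed.

Lemma green_sub (u v : H1 O2) f g (D : set (R * R)) h k q p :
  L2 leb2 O2 f -> L2 leb2 O2 g -> L2 ell S h -> L2 ell S k ->
  L2 mu J q -> L2 mu J p ->
  green ell u f D S h q -> green ell v g D S k p ->
  green ell (H1_sub mO2 u v) (fun x => f x - g x) D S (fun x => h x - k x)
    (fun z => q z - p z).
Proof.
move=> fL gL hL kL qL pL ug vg w s ws s0.
have wS := trace_TB2_L2 ws; have wJ := trace_interface_L2 ws.
have mJ : measurable J by exact: measurable_itv.
have mS := Gamma_TB2_measurable G.
have mO := mO2.
have wL := H1_funL2 w; have wxL := H1_dxL2 w; have wzL := H1_dzL2 w.
rewrite !Rintegral_mulBl//.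
have -> : \int[leb2]_(x in O2) (H1_dx (H1_sub mO2 u v) x * H1_dx w x +
      H1_dz (H1_sub mO2 u v) x * H1_dz w x) =
    \int[leb2]_(x in O2) (H1_dx u x * H1_dx w x + H1_dz u x * H1_dz w x) -
    \int[leb2]_(x in O2) (H1_dx v x * H1_dx w x + H1_dz v x * H1_dz w x).
  have iP (a b c e : R * R -> R) : L2 leb2 O2 a -> L2 leb2 O2 b ->
      L2 leb2 O2 c -> L2 leb2 O2 e ->
      leb2.-integrable O2 (EFin \o (fun x => a x * b x + c x * e x)).
    move=> aL bL cL eL.
    exact: (integrableD mO2 (L2_mul_integrable mO2 aL bL)
      (L2_mul_integrable mO2 cL eL)).
  rewrite -RintegralB//; last 2 first.
  - by apply: iP => //; [exact: H1_dxL2|exact: H1_dzL2].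
  - by apply: iP => //; [exact: H1_dxL2|exact: H1_dzL2].
  by apply: eq_Rintegral => x _ /=; ring.
by rewrite (ug _ _ ws s0) (vg _ _ ws s0); ring.
Qed.

Lemma problem2_sub (kappa lambda : R) f gamma g g' u t q v s p :
  L2 leb2 O2 f ->
  problem2 ell kappa lambda f gamma g u t q ->
  problem2 ell kappa lambda f gamma g' v s p ->
  problem2 ell kappa lambda (fun=> 0) (fun=> 0) (fun z => g z - g' z)
    (H1_sub mO2 u v) (fun x => t x - s x) (fun z => q z - p z).
Proof.
move=> fL [ut qL ug uD uR] [vs pL vg vD vR]; split.
- exact: is_trace_sub.
- exact: L2B.
- have := green_sub fL fL (robin_flux_L2 kappa ut) (robin_flux_L2 kappa vs)
    qL pL ug vg.
  congr green; apply/funext => x; first by rewrite subrr.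
  by ring.
- by apply: filterS2 uD vD => x + + xR => /(_ xR) -> /(_ xR) ->; rewrite subrr.
- apply: filterS2 uR vR => z + + zH => /(_ zH) <- /(_ zH) <-.
  by ring.
Qed.

(** A test function with zero trace on the whole boundary but the interface
    vanishes on [Gamma_R] and kills the Robin term on the bottom. *)
Lemma problem2_is_flux (kappa lambda : R) f gamma g (u : H1 O2) t q :
  L2 leb2 O2 f -> problem2 ell kappa lambda f gamma g u t q ->
  is_flux ell u q.
Proof.
move=> fL [ut qL ug _ _]; split=> //; exists f => // v s vs s0.
have mS := Gamma_TB2_measurable G.
rewrite (ug v s vs); last first.
  by apply: filterS s0 => p sp0 /(@Gamma_R_wall _ G); exact: sp0.
rewrite Rintegral_set0; congr (_ + _ - _); apply: Rintegral_ae_eq0 => //.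
  apply: measurable_funM.
    exact: L2_measurable (robin_flux_L2 kappa ut).
  exact: L2_measurable (trace_TB2_L2 vs).
by apply: filterS s0 => p sp0 /(@Gamma_TB2_wall _ G) pw; rewrite sp0// mulr0.
Qed.

(** Test the weak form with the solution itself. *)
Lemma problem2_energy (kappa lambda : R) g (u : H1 O2) t q : 0 <= kappa ->
  problem2 ell kappa lambda (fun=> 0) (fun=> 0) g u t q ->
  \int[mu]_(z in J) (q z * t (L, z)) <= 0.
Proof.
move=> k0 [ut _ ug uD _].
have := ug u t ut uD.
rewrite Rintegral_mul0l.
set A := \int[leb2]_(p in O2) _; set B := \int[ell]_(p in S) _.
set C := \int[mu]_(z in J) _ => E.
have A0 : 0 <= A.
  by apply: Rintegral_ge0 => p _; rewrite addr_ge0// -expr2 sqr_ge0.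
have B0 : B <= 0.
  apply: Rintegral_le0 => p _; rewrite indicE; case: (_ \in _).
    by rewrite mulr1 -mulrA mulNr oppr_le0 mulr_ge0// -expr2 sqr_ge0.
  by rewrite mulr0 mul0r.
by move: E; rewrite add0r -/C; lra.
Qed.

(** With [s = q + lambda t], integrate
    [s^2 = (- q + lambda t)^2 + 4 lambda q t], whose last term contributes a
    nonpositive amount and whose first one is the constant [r^2]. *)
Lemma problem2_homogeneous_bound (kappa lambda r : R) (u : H1 O2) t q :
  0 <= kappa -> 0 < lambda ->
  problem2 ell kappa lambda (fun=> 0) (fun=> 0) (fun=> r) u t q ->
  `|vmean H q + lambda * vmean H (fun z => t (L, z))| <= `|r|.
Proof.
move=> k0 l0 uP; have := problem2_energy k0 uP.
have [ut qL _ _ uR] := uP; have tL := trace_interface_L2 ut.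
set tG := fun z => t (L, z) => qt0.
have mJ : measurable J by exact: measurable_itv.
have H0 := height_gt0 G.
have sE : vmean H q + lambda * vmean H tG =
    vmean H (fun z => 1 * q z + lambda * tG z) by rewrite vmean_lin// mul1r.
have diff : \int[mu]_(z in J) ((-1 * q z + lambda * tG z) ^+ 2) = r ^+ 2 * H.
  rewrite (@Rintegral_ae_eq _ _ _ mu J _ (fun=> r ^+ 2))//.
  - by rewrite Rintegral_cst// fine_itv_measure.
  - apply: measurable_funX; apply: L2_measurable (L2_lin _ _ qL tL).
    exact: mJ.
  - by apply: filterS uR => z zR zJ; rewrite mulN1r zR.
rewrite sE -ler_sqr ?nnegrE// !real_normK ?num_real//.
rewrite -(ler_pM2l H0).
apply: (le_trans (vmean_sqr_le H0 (L2_lin 1 lambda qL tL))).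
rewrite -/tG in qt0 *.
under eq_Rintegral do rewrite -expr2.
move: diff; rewrite !Rintegral_sqr_comb// => diff.
by move: qt0; rewrite -/(tG _); nra.
Qed.

Lemma problem2_stability (kappa lambda : R) f gamma r r' (u v : H1 O2) t q s p :
  0 <= kappa -> 0 < lambda -> L2 leb2 O2 f ->
  problem2 ell kappa lambda f gamma (fun=> r) u t q ->
  problem2 ell kappa lambda f gamma (fun=> r') v s p ->
  `|vmean H q + lambda * vmean H (fun z => t (L, z)) -
    (vmean H p + lambda * vmean H (fun z => s (L, z)))| <= `|r - r'|.
Proof.
move=> k0 l0 fL uP vP.
have := problem2_homogeneous_bound k0 l0 (problem2_sub fL uP vP).
have [ut qL _ _ _] := uP; have [vs pL _ _ _] := vP.
rewrite (vmeanB (trace_interface_L2 ut) (trace_interface_L2 vs)) (vmeanB qL pL).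
by congr (`|_| <= _); ring.
Qed.

Lemma problem2_vmean_robin (kappa lambda : R) f gamma r (u : H1 O2) t q :
  problem2 ell kappa lambda f gamma (fun=> r) u t q ->
  - vmean H q + lambda * vmean H (fun z => t (L, z)) = r.
Proof.
move=> [ut qL _ _ uR]; have tL := trace_interface_L2 ut.
have mJ : measurable J by exact: measurable_itv.
have H0 := height_gt0 G.
rewrite -mulN1r -vmean_lin// /vmean.
rewrite (@Rintegral_ae_eq _ _ _ mu J _ (fun=> r))//.
- by rewrite Rintegral_cst// fine_itv_measure// mulrC mulfK// gt_eqF.
- exact: L2_measurable (L2_lin _ _ qL tL).
- by apply: filterS uR => z zR zJ; rewrite mulN1r zR.
Qed.

End TwoDimensionalProblem.

(** * Convergence of the Schwarz iteration *)

Section Limits.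
Context (R : realType).

(** The limit is given as an affine combination of the first two terms so that
    the limit interval problem, which is affine in its datum, can be solved by
    the same combination of the first two iterates. When these two terms agree,
    the sequence is constant and any coefficient will do. *)
Lemma contraction_cvg (s : nat -> R) (theta : R) : 0 <= theta < 1 ->
  (forall k, `|s k.+2 - s k.+1| <= theta * `|s k.+1 - s k|) ->
  exists c, s @ \oo --> s 0%N + c * (s 1%N - s 0%N).
Proof.
move=> /andP[th0 th1] sS.
have geo k : `|s k.+1 - s k| <= `|s 1%N - s 0%N| * theta ^+ k.
  elim: k => [|k IH]; first by rewrite expr0 mulr1.
  by rewrite (le_trans (sS k))// exprS mulrCA ler_wpM2l.
have cvs : cvg (s @ \oo).
  have -> : s = (fun n => s 0%N + series (fun k => s k.+1 - s k) n).
    apply/funext => n; rewrite /series /=.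
    by rewrite telescope_sumr// subrKC.
  apply: is_cvgD; first exact: is_cvg_cst.
  apply: normed_cvg; apply: series_le_cvg geo _ => //.
  - by move=> n; rewrite mulr_ge0// exprn_ge0.
  - by apply: is_cvg_geometric_series; rewrite ger0_norm.
have [s01|s01] := eqVneq (s 1%N) (s 0%N).
  exists 0; rewrite mul0r addr0.
  have -> : s = cst (s 0%N); last exact: cvg_cst.
  apply/funext => n; elim: n => // n /=; rewrite /cst => IH; rewrite -[RHS]IH.
  apply/eqP; rewrite -subr_eq0 -normr_eq0 eq_le normr_ge0 andbT.
  by rewrite (le_trans (geo n))// s01 subrr normr0 mul0r.
exists ((lim (s @ \oo) - s 0%N) / (s 1%N - s 0%N)).
by rewrite divfK ?subr_eq0// subrKC.
Qed.

Lemma norm_squeeze0 (C : R) (x y : nat -> R) :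
  (forall n, `|x n| <= C * `|y n|) -> y @ \oo --> 0 -> x @ \oo --> 0.
Proof.
move=> xy y0; apply/norm_cvg0P.
apply: (@squeeze_cvgr _ _ _ _ (cst 0) (fun n => C * `|y n|)).
- by apply: nearW => n; rewrite normr_ge0/=.
- exact: cvg_cst.
- rewrite -[X in _ --> X](mulr0 C).
  by apply: cvgM; [exact: cvg_cst|exact/norm_cvg0P].
Qed.

Lemma cvg_mul_sqr0 (C : R) (x : nat -> R) : x @ \oo --> 0 ->
  (fun n => (C * x n ^+ 2)%:E) @ \oo --> 0%E.
Proof.
move=> x0; apply: cvg_EFin; first exact: nearW.
have -> : 0 = C * (0 * 0) by rewrite !mulr0.
rewrite (_ : _ \o _ = fun n => C * (x n * x n)).
  by apply: cvgM; [exact: cvg_cst|exact: cvgM].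
by apply/funext => n /=; rewrite expr2.
Qed.

End Limits.

Theorem proposition1 (R : realType) (G : geometry R)
    (ell : {measure set (measurableTypeR R * measurableTypeR R) -> \bar R})
    (hell : is_arc_length ell)
    (kappa : R) (hkappa : 0 <= kappa)
    (F gamma1 gamma2 : R * R -> R)
    (hF : L2 leb2 (Omega G) F)
    (hgamma1 : L2 (@lebesgue_measure R) `]0, height G[
                 (fun z => gamma1 (0, z)))
    (hgamma2 : exists w : H1 (Omega2 G), lifts ell w gamma2)
    (lambda : R) (hlambda : 0 < lambda)
    (hwp : well_posed2 G ell kappa lambda)
    (u1_ du1_ : nat -> H1I (L0 G))
    (u2_ : nat -> H1 (Omega2 G))
    (t_ : nat -> R * R -> R) (q_ : nat -> R -> R)
    (hiter : schwarz_iterates ell kappa lambda F gamma1 gamma2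
               u1_ du1_ u2_ t_ q_) :
  exists (u1 du1 : H1I (L0 G)) (u2 : H1 (Omega2 G))
         (t : R * R -> R) (q : R -> R),
    [/\ H1I_cvg u1_ u1 /\ H1_cvg u2_ u2,
        [/\ is_derivative u1 du1, is_trace ell u2 t & is_flux ell u2 q],
        u1 (L0 G) = vmean (height G) (fun z => t (L0 G, z)) &
        du1 (L0 G) = vmean (height G) q].
Proof.
have [_ _ iter] := hiter.
have [wp_ex _ [C wp_bound]] := hwp.
set H := height G; set L := L0 G.
have H0 : 0 < H := height_gt0 G; have Lgt0 : 0 < L := L0_gt0 G.
have mO2 := Omega2_measurable G.
have mJ : measurable (`]0, H[%classic : set (measurableTypeR R)).
  exact: measurable_itv.
have [openO _ _] := Omega_domain G.
have FL : L2 leb2 (Omega2 G) F.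
  by apply: L2S hF => //; [exact: open_measurable_plane|exact: subIsetl].
pose theta := robin_rate lambda L (kappa / H).
have theta01 : 0 <= theta < 1.
  by apply: robin_rate_bounds => //; rewrite divr_ge0// ltW.
pose s_ k := vmean H (q_ k) + lambda * vmean H (fun z => t_ k (L, z)).
pose out (u du : H1I L) : R := lambda * u L - du L.
have outE k : - du1_ k.+1 L + lambda * u1_ k.+1 L = out (u1_ k.+1) (du1_ k.+1).
  by rewrite /out addrC.
have sS k : `|s_ k.+2 - s_ k.+1| <= theta * `|s_ k.+1 - s_ k|.
  have [u1P u2P] := iter k; have [v1P v2P] := iter k.+1.
  apply: le_trans (problem2_stability hkappa hlambda FL v2P u2P) _.
  by rewrite !outE; have [] := problem1_stability hkappa hlambda v1P u1P.
have [c s_cvg] := contraction_cvg theta01 sS.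
set s := _ + _ in s_cvg.
pose u1 : H1I L := H1I_comb (1 - c) c (u1_ 1%N) (u1_ 2%N).
pose du1 : H1I L := H1I_comb (1 - c) c (du1_ 1%N) (du1_ 2%N).
have [u1P _] := iter 0%N; have [v1P _] := iter 1%N.
have u1lim : problem1 kappa lambda (fun x => vmean H (fun z => F (x, z)))
    (vmean H (fun z => gamma1 (0, z))) s u1 du1.
  have := problem1_comb (1 - c) c u1P v1P.
  congr problem1.
  - by apply/funext => x; rewrite -mulrDl subrK mul1r.
  - by rewrite -mulrDl subrK mul1r.
  - by rewrite /s /s_; ring.
have [u2 [t [q u2P]]] : exists (u : H1 (Omega2 G)) t q,
    problem2 ell kappa lambda F gamma2 (fun=> out u1 du1) u t q.
  by apply: wp_ex => //; apply: (L2_cst _ mJ); exact: itv_measure_fin.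
exists u1, du1, u2, t, q.
have sn0 : (fun n => s_ n - s) @ \oo --> (0 : R).
  by rewrite -(subrr s); apply: cvgB => //; exact: cvg_cst.
have rn0 :
    (fun n => out (u1_ n.+1) (du1_ n.+1) - out u1 du1) @ \oo --> (0 : R).
  apply: (norm_squeeze0 (C := theta) _ sn0) => n; have [uP _] := iter n.
  by have [] := problem1_stability hkappa hlambda uP u1lim.
(* the limit plane solution returns the datum of the limit interval problem *)
have sE : vmean H q + lambda * vmean H (fun z => t (L, z)) = s.
  have s'_cvg : (fun n => s_ n.+1) @ \oo -->
      vmean H q + lambda * vmean H (fun z => t (L, z)).
    apply/subr_cvg0; apply: (norm_squeeze0 (C := 1) _ rn0) => n.
    have [_ uP] := iter n; rewrite mul1r -outE.
    exact: problem2_stability hkappa hlambda FL uP u2P.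
  rewrite -(cvg_lim (@Rhausdorff R) s'_cvg); apply: cvg_lim => //.
  by rewrite (cvg_shiftS s_).
have [u1_du1 _ _ u1L] := u1lim; have [u2t _ _ _ _] := u2P.
have rE := problem2_vmean_robin u2P.
split.
- split.
    split; apply: L2_cvg_shiftS.
    + exact: H1I_L2.
    + apply: L2_cvg_squeeze (cvg_mul_sqr0 (L / lambda ^+ 2) sn0).
      * by move=> n; exact: H1I_L2.
      * exact: H1I_L2.
      * move=> n; have [uP _] := iter n.
        by have [] := problem1_stability hkappa hlambda uP u1lim.
    + exact: H1I_dL2.
    + apply: L2_cvg_squeeze (cvg_mul_sqr0 L sn0).
      * by move=> n; exact: H1I_dL2.
      * exact: H1I_dL2.
      * move=> n; have [uP _] := iter n.
        by have [] := problem1_stability hkappa hlambda uP u1lim.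
  apply: (H1_cvg_of_sqnorm (mU := mO2)) (cvg_mul_sqr0 (C * H) rn0) => n.
  have [_ uP] := iter n; rewrite outE in uP.
  have cL := L2_cst (out (u1_ n.+1) (du1_ n.+1) - out u1 du1) mJ
    (itv_measure_fin 0 H).
  have := wp_bound _ _ _ _ _ _ _ (L20 leb2 _) (lifts_zero G ell) cL
    (problem2_sub FL uP u2P).
  congr (_ <= _)%E; rewrite L2_sqnorm_zero H1_sqnorm_zero !add0e.
  by rewrite -mulrA EFinM -(L2_sqnorm_itv_cst _ H0).
- by split=> //; exact: problem2_is_flux FL u2P.
- have : 2 * lambda * u1 L = 2 * lambda * vmean H (fun z => t (L, z)).
    by move: u1L rE sE; rewrite /out; lra.
  by apply: mulfI; rewrite mulf_neq0// gt_eqF.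
- by move: u1L rE sE; rewrite /out; lra.
Qed.
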